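(* There exist absolute constants $C_1,C_2>0$ such that the following holds. For every $0<\beta<\frac14$ there exist $n_0,\gamma,\eta>0$ such that for every $n\ge n_0$ and for every $d,\lambda>0$ satisfying $\frac d\lambda\ge\frac1\eta$: if $G$ is an $(n,d,\lambda)$-graph, then for any integer $t$ with $\frac{C_1}{\log(1/\beta)}\cdot\log n\le t\le(1-C_2\beta)n$, every subgraph $G'$ of $G$ with $$e(G')\ge\left(g^\gamma(t,n)+\beta\right)e(G)$$ edges contains a cycle of length $t$.
   Context: Graphs are finite and simple; $e(G)$ is the number of edges of $G$; $\log$ is the natural logarithm; the length of a cycle is its number of edges. A graph $G$ is an $(n,d,\lambda)$-graph if it has $n$ vertices, is $d$-regular, and the second largest (in absolute value) eigenvalue of its adjacency matrix is bounded from above (in absolute value) by $\lambda$. The function $g^\gamma(t,n)$, for a parameter $\gamma>0$ (cases read in the order listed): if $t$ is odd, $g^\gamma(t,n)$ is defined by $$g^\gamma(t,n)\binom n2=\begin{cases}\binom{t-1}2+\binom{n-t+2}2+1,& t\ge \frac12(n+3),\\ \lfloor \frac14n^2\rfloor+1,& t<\frac12(n+3);\end{cases}$$ if $t$ is even, $$g^\gamma(t,n)\binom n2=\begin{cases}\binom{t-1}2+\binom{n-t+2}2+1,& t\ge \frac12(n+3),\\ \lfloor \frac12n(t-1)\rfloor+1,& \gamma n\le t<\frac12(n+3),\\ 0,& t<\gamma n.\end{cases}$$ *)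

(* Defs.v *)
From mathcomp Require Import all_boot all_order all_algebra.
From mathcomp Require Import reals exp.

Set Implicit Arguments.
Unset Strict Implicit.
Unset Printing Implicit Defensive.

Import Order.TTheory GRing.Theory Num.Theory.

Local Open Scope ring_scope.

Record sgraph (T : finType) := SGraph {
  adj :> rel T;
  adj_sym : symmetric adj;
  adj_irrefl : irreflexive adj
}.

(* Not necessarily spanning or induced. *)
Record subgraph (T : finType) (G : sgraph T) := Subgraph {
  sub_vert : {set T};
  sub_adj :> rel T;
  sub_adj_sym : symmetric sub_adj;
  sub_adj_sub : subrel sub_adj G;
  sub_adj_vert : forall x y : T, sub_adj x y -> x \in sub_vert
}.

Definition edges (T : finType) (e : rel T) : {set {set T}} :=
  [set A : {set T} | [exists x : T, exists y : T, e x y && (A == [set x; y])]].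

(* Without 3 <= t, any edge x y would give a cycle [:: x; y] for ucycle. *)
Definition has_cycle (T : finType) (e : rel T) (t : nat) : Prop :=
  (3 <= t)%N /\ exists c : seq T, size c = t /\ ucycle e c.

Definition regular (T : finType) (e : rel T) (d : nat) : Prop :=
  forall x : T, #|[set y : T | e x y]| = d.

Definition adj_mx (R : realType) (T : finType) (e : rel T) : 'M[R]_#|T| :=
  \matrix_(i, j) (e (enum_val i) (enum_val j))%:R.

(* s lists the eigenvalues of A with multiplicity, by decreasing absolute
   value. Such a list exists when A is symmetric, and the sequence of absolute
   values is determined by A. *)
Definition eigenvalues_of (R : realType) (n : nat) (A : 'M[R]_n) (s : seq R) :
    Prop :=
  char_poly A = \prod_(x <- s) ('X - x%:P) /\
  sorted (fun x y : R => `|y| <= `|x|) s.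

(* s`_1 is the second entry of s. *)
Definition ndl_graph (R : realType) (T : finType) (G : sgraph T)
    (n d : nat) (lambda : R) : Prop :=
  [/\ #|T| = n,
      regular G d &
      exists s : seq R, eigenvalues_of (adj_mx R G) s /\ `|s`_1| <= lambda].

(* The value of g^gamma(t, n) * 'C(n, 2). The quotients %/ are the floors of
   the corresponding rationals; the truncated subtractions are exact for
   1 <= t <= n + 2. *)
Definition g_num (R : realType) (gamma : R) (t n : nat) : nat :=
  if odd t then
    if (n%:R + 3) / 2 <= t%:R :> R then
      ('C(t - 1, 2) + 'C(n + 2 - t, 2) + 1)%N
    else (n ^ 2 %/ 4 + 1)%N
  else
    if (n%:R + 3) / 2 <= t%:R :> R then
      ('C(t - 1, 2) + 'C(n + 2 - t, 2) + 1)%N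
    else if gamma * n%:R <= t%:R then
      ((n * (t - 1)) %/ 2 + 1)%N
    else 0%N.

Definition g (R : realType) (gamma : R) (t n : nat) : R :=
  (g_num gamma t n)%:R / 'C(n, 2)%:R.

(* Main.v *)
(* Call a pair of vertex sets m-joined if any two subsets of size at least m
   are joined by an edge of G'.  Refining a partition by witnesses increases the
   number of point pairs lying in edgeless pairs of blocks, so after boundedly
   many steps almost all pairs of blocks are edgeless or m-joined; no edge
   densities are involved.  By the expander mixing lemma almost all edges of G'
   lie in joined pairs, hence the reduced graph of joined pairs (loops allowed)
   has density at least g + 9/10 beta.  The defect version of Hall's theorem,
   applied to each component, yields a component of the reduced graph (with an
   odd closed walk if t is odd) and a partial injection along its edges of
   relative size greater than t/n; halving the blocks turns the injection into a
   matching.  In each matched pair depth-first search finds a path of any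
   prescribed length covering nearly everything, trees of exact depth l at both
   of its ends reach m vertices, and these sets are linked through reserved
   vertices along walks of the reduced graph.  All lengths are prescribed, so
   the resulting cycle has length exactly t. *)
Require Import Defs.
From mathcomp Require Import all_boot all_order all_algebra.
From mathcomp Require Import reals exp.
From mathcomp Require sequences.
From mathcomp Require Import complex zify lra ring.

Set Implicit Arguments.
Unset Strict Implicit.
Unset Printing Implicit Defensive.

(** * Joined pairs and depth-first search *)

(** The scale [m] is a constant fraction of the number of vertices, and joinedness at this scale
    passes to all subsets, so blocks can be cut into pieces at no cost, however sparse the graph is.
    Its weakness is that it yields some edge between two large sets and says nothing about a chosen
    vertex. Hence no piece of the cycle can have prescribed ends: every segment is built so that any
    of at least [m] starts and any of at least [m] ends are joined inside it by a path with the same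
    number of vertices. This is what the trees are for. Their branching is at least 1000/beta and
    they need at least [m] leaves, so depth about log n / log(1/beta) suffices, whence the lower
    bound on [t]. Parity is controlled in the bipartite double cover of the reduced graph: for odd
    [t] the two copies of a block must be connected there. The obstacles are then bipartite
    components and two disjoint cliques of relative sizes sigma and 1 - sigma. The value sigma
    exceeds t/n by at least beta/8; this surplus pays for trees, links, uncovered vertices and
    vertices abandoned by the search. *)

Lemma leq_cardsU (T : finType) (A B : {set T}) : #|A :|: B| <= #|A| + #|B|.
Proof. by rewrite cardsU leq_subr. Qed.

Section Joined.

Variables (T : finType) (e : rel T).
Implicit Types (A B X Y Z : {set T}).

(** Unlike a lower bound on density, this passes to arbitrary subsets with the same [m]; it holds
    vacuously if one of the sets is smaller than [m]. *)
Definition joined (m : nat) (A B : {set T}) : bool :=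
  [forall X : {set T}, forall Y : {set T},
     [&& X \subset A, Y \subset B, m <= #|X| & m <= #|Y|] ==>
     [exists x in X, exists y in Y, e x y]].

Lemma joinedP m (A B : {set T}) :
  reflect (forall X Y : {set T}, X \subset A -> Y \subset B ->
             m <= #|X| -> m <= #|Y| ->
             exists x y, [/\ x \in X, y \in Y & e x y])
          (joined m A B).
Proof.
apply: (iffP idP) => [/forallP H X Y XA YB mX mY | H].
  have /forallP/(_ Y)/implyP := H X.
  by rewrite XA YB mX mY => /(_ isT)/exists_inP[x Xx /exists_inP[y Yy exy]]; exists x, y.
apply/forallP => X; apply/forallP => Y; apply/implyP => /and4P[XA YB mX mY].
have [x [y [Xx Yy exy]]] := H X Y XA YB mX mY.
by apply/exists_inP; exists x => //; apply/exists_inP; exists y.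
Qed.

Lemma joinedS m (A B A' B' : {set T}) :
  A' \subset A -> B' \subset B -> joined m A B -> joined m A' B'.
Proof.
move=> sA sB /joinedP J; apply/joinedP => X Y XA YB; apply: J.
  exact: subset_trans XA sA.
exact: subset_trans YB sB.
Qed.

Lemma joined_sym m (A B : {set T}) : symmetric e -> joined m A B -> joined m B A.
Proof.
move=> es /joinedP J; apply/joinedP => X Y XB YA mX mY.
by have [x [y [Yx Xy exy]]] := J Y X YA XB mY mX; exists y, x; rewrite es.
Qed.

Definition nbhd (X : {set T}) : {set T} := [set y | [exists x in X, e x y]].

Lemma nbhdP X y : reflect (exists2 x, x \in X & e x y) (y \in nbhd X).
Proof. by rewrite inE; apply: (iffP exists_inP). Qed.

Lemma joined_nbhd m (A B X : {set T}) : joined m A B -> X \subset A -> m <= #|X| ->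
  #|B :\: nbhd X| < m.
Proof.
move=> /joinedP J XA mX; rewrite ltnNge; apply/negP => mB.
have [|x [y [Xx]]] := J X (B :\: nbhd X) XA _ mX mB; first exact: subsetDl.
rewrite inE => /andP[/negP nY _] exy; apply: nY.
by apply/nbhdP; exists x.
Qed.

Lemma subset_of_card (A : {set T}) k : k <= #|A| ->
  exists2 B : {set T}, B \subset A & #|B| = k.
Proof.
move=> kA; exists [set x in take k (enum A)].
  by apply/subsetP => x; rewrite inE => /mem_take; rewrite mem_enum.
rewrite cardsE (card_uniqP _) ?take_uniq ?enum_uniq //.
by rewrite size_takel // -cardE.
Qed.

End Joined.

Section DepthFirstSearch.

Variables (T : finType) (e : rel T) (I : finType).
Variables (U : I -> {set T}) (c : nat -> I) (L m : nat).
Hypothesis e_sym : symmetric e.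
Hypothesis U_disj : forall i i' x, x \in U i -> x \in U i' -> i = i'.
Hypothesis m_gt0 : 0 < m.
Hypothesis cJ : forall j, j < L -> joined e m (U (c j)) (U (c j.+1)).
Hypothesis capU : forall i,
  count (fun j => c j == i) (iota 0 L.+1) + #|I|.+1 * m <= #|U i|.

Implicit Types (s : seq T) (D : I -> I -> {set T}).

(** The newest vertex is the head of the stack, so the length of the tail is the position of the
    head on the path. *)
Fixpoint fits (s : seq T) : bool :=
  if s is v :: s' then (v \in U (c (size s'))) && fits s' else true.

Lemma fits_count i s : fits s -> size s <= L.+1 ->
  count (mem (U i)) s <= count (fun j => c j == i) (iota 0 L.+1).
Proof.
move=> fs sL; apply: (@leq_trans (count (fun j => c j == i) (iota 0 (size s)))).
  elim: s fs {sL} => // v s IH /andP[vU fs].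
  rewrite [size _]/= -addn1 iotaD count_cat add0n /= addn0 addnC.
  rewrite leq_add ?IH //.
  case vi: (v \in U i) => //=.
  by rewrite (U_disj vU vi) eqxx.
by rewrite -(subnKC sL) iotaD count_cat leq_addr.
Qed.

Definition visited (s : seq T) (D : I -> I -> {set T}) i : {set T} :=
  [set x | x \in s] :|: \bigcup_i' D i i'.

(* [s] is the current path, top of the stack first; [D i i'] collects the
   vertices of [U i] abandoned while looking for a next vertex in [U i']. *)
Record dfs_inv (s : seq T) (D : I -> I -> {set T}) : Prop := DfsInv {
  inv_uniq : uniq s;
  inv_sorted : sorted e s;
  inv_fits : fits s;
  inv_size : size s <= L.+1;
  inv_sub : forall i i', D i i' \subset U i;
  inv_small : forall i i', #|D i i'| < m;
  inv_dead : forall i i' x y, x \in D i i' -> y \in U i' -> e x y ->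
    y \in visited s D i' }.

(** Of the surplus in [capU], [#|I| * m] pays for the abandoned vertices, one batch per target
    class, and [m] vertices remain. The bound on [D] is not strict because the lemma is applied to a
    set that has just received one more vertex. *)
Lemma unvisited_large s D i : fits s -> size s <= L.+1 ->
  (forall i', #|D i i'| <= m) -> m <= #|U i :\: visited s D i|.
Proof.
move=> fs sL Dm.
have h1 : #|U i| <= #|U i :\: visited s D i| + (#|U i :&: [set x | x \in s]| + #|\bigcup_i' D i i'|).
  rewrite -(cardsID (visited s D i) (U i)) addnC leq_add2l.
  rewrite setIUr; apply: leq_trans (leq_cardsU _ _) _.
  by rewrite leq_add2l subset_leq_card // subsetIr.
have h2 : #|U i :&: [set x | x \in s]| <= count (mem (U i)) s.
  rewrite -size_filter; apply: leq_trans (card_size _).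
  apply: subset_leq_card; apply/subsetP => x; rewrite !inE mem_filter.
  by move=> /andP[xU xs]; apply/andP; split.
have h3 : #|\bigcup_i' D i i'| <= #|I| * m.
  apply: (@leq_trans (\sum_i' #|D i i'|)).
    elim/big_rec2: _ => [|i' a b _ h]; first by rewrite cards0.
    by apply: leq_trans (leq_cardsU _ _) _; rewrite leq_add2l.
  rewrite -sum_nat_const; apply: leq_sum => i' _; exact: Dm.
have h4 := fits_count i fs sL.
have := capU i; rewrite mulSn => h5.
by lia.
Qed.

Definition dfs_all s (D : I -> I -> {set T}) : {set T} :=
  [set x | x \in s] :|: \bigcup_i \bigcup_i' D i i'.

Lemma visited_all s D i x : dfs_inv s D -> x \in U i -> x \in dfs_all s D ->
  x \in visited s D i.
Proof.
move=> inv Ux; rewrite !inE => /orP[-> //|/bigcupP[i1 _ /bigcupP[i' _ xD]]].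
have E := U_disj (subsetP (inv_sub inv i1 i') _ xD) Ux; rewrite E in xD.
by apply/orP; right; apply/bigcupP; exists i'.
Qed.

Lemma dfs_push s D u : dfs_inv s D -> size s <= L -> u \in U (c (size s)) ->
  u \notin visited s D (c (size s)) ->
  (if s is v :: _ then e v u else true) ->
  dfs_inv (u :: s) D /\ #|~: dfs_all (u :: s) D| < #|~: dfs_all s D|.
Proof.
move=> inv sL uU nv eu; split.
  split=> /=.
  - rewrite (inv_uniq inv) andbT; apply: contra nv => us.
    by rewrite !inE us.
  - case: s eu inv {sL uU nv} => [|v s] //= evu /inv_sorted /= ->.
    by rewrite e_sym evu.
  - by rewrite uU (inv_fits inv).
  - by rewrite ltnS.
  - exact: inv_sub inv.
  - exact: inv_small inv.
  - move=> i i' x y xD yU exy.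
    have := inv_dead inv xD yU exy; rewrite !inE => /orP[->|->]; rewrite ?orbT //.
apply: proper_card; rewrite properE !setCS; apply/andP; split.
  by apply/subsetP => x; rewrite !inE => /orP[->|->]; rewrite ?orbT.
apply/negP => /subsetP/(_ u); rewrite !inE eqxx => /(_ isT) H.
by move/negP: nv; apply; apply: visited_all => //; rewrite !inE.
Qed.

Lemma dfs_pop v s D : dfs_inv (v :: s) D -> size s < L ->
  (forall u, u \in U (c (size s).+1) -> e v u ->
     u \in visited (v :: s) D (c (size s).+1)) ->
  exists D', dfs_inv s D' /\ dfs_all s D' = dfs_all (v :: s) D.
Proof.
move=> inv sL nou.
pose i0 := c (size s); pose i1 := c (size s).+1.
have vU : v \in U i0 by have := inv_fits inv => /= /andP[].
pose D' i i' := if (i == i0) && (i' == i1) then v |: D i i' else D i i'.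
have DD' i i' : D i i' \subset D' i i'.
  by rewrite /D'; case: ifP => // _; apply: subsetUr.
have D'E i i' x : x \in D' i i' -> [/\ x = v, i = i0 & i' = i1] \/ x \in D i i'.
  rewrite /D'; case: ifP => [/andP[/eqP-> /eqP->]|_]; last by right.
  by rewrite !inE => /orP[/eqP->|]; [left|right].
have vD' : v \in D' i0 i1 by rewrite /D' !eqxx !inE eqxx.
have visE i y : y \in U i -> y \in visited (v :: s) D i -> y \in visited s D' i.
  move=> yU; rewrite !inE => /orP[/orP[/eqP E|->//]|/bigcupP[i' _ yD]].
    rewrite E in yU *; rewrite (U_disj yU vU).
    by apply/orP; right; apply/bigcupP; exists i1.
  apply/orP; right; apply/bigcupP; exists i' => //.
  exact: (subsetP (DD' _ _)).
have fs : fits s by have := inv_fits inv => /= /andP[].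
have ss : size s <= L.+1 by have := inv_size inv => /=; lia.
have dead' i i' x y : x \in D' i i' -> y \in U i' -> e x y ->
    y \in visited s D' i'.
  move=> /D'E[[-> _ ->]|xD] yU exy; apply: visE => //; first exact: nou.
  exact: inv_dead inv _ _ _ _ xD yU exy.
have D'le i i' : #|D' i i'| <= m.
  rewrite /D'; case: ifP => _; last exact: ltnW (inv_small inv _ _).
  by have := inv_small inv i i'; rewrite cardsU1; case: (v \notin _) => /=; lia.
have D'sub i i' : D' i i' \subset U i.
  by apply/subsetP => x /D'E[[-> -> _] //|]; apply/subsetP/(inv_sub inv).
(* If [m] vertices were abandoned towards a class, joinedness would give an edge from them to one of
   the at least [m] unvisited vertices of that class, which [dead'] forbids. *)
have D'm i i' : #|D' i i'| < m.
  case E: ((i == i0) && (i' == i1)); last first.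
    by rewrite /D' E; apply: inv_small inv _ _.
  have [/eqP-> /eqP->] := andP E.
  rewrite ltnNge; apply/negP => mD.
  have /joinedP J := cJ sL.
  have mU := unvisited_large fs ss (D'le i1).
  have [x [y [xD]]] := J _ _ (D'sub _ _) (subsetDl _ _) mD mU.
  rewrite inE => /andP[/negP ny yU] exy; apply: ny.
  exact: dead' xD yU exy.
exists D'; split.
  split=> //.
  - by have := inv_uniq inv => /= /andP[].
  - by have := inv_sorted inv => /=; apply: path_sorted.
apply/setP => x; rewrite !inE -orbA orbCA; congr (_ || _).
apply/bigcupP/orP => [[i _ /bigcupP[i' _ /D'E[[-> _ _]|xD]]]|].
- by left.
- by right; apply/bigcupP; exists i => //; apply/bigcupP; exists i'.
- case=> [/eqP->|/bigcupP[i _ /bigcupP[i' _ xD]]].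
    by exists i0 => //; apply/bigcupP; exists i1.
  by exists i => //; apply/bigcupP; exists i' => //; apply: (subsetP (DD' _ _)).
Qed.

(** The measure decreases in both moves: a push uses up a fresh vertex, counted twice, and lengthens
    the stack by one; a pop leaves the set of touched vertices unchanged and shortens the stack. *)
Lemma dfs_run N s D : #|~: dfs_all s D|.*2 + size s < N -> dfs_inv s D ->
  exists p, [/\ size p = L.+1, uniq p, sorted e p & fits p].
Proof.
elim: N s D => // N IH s D; rewrite ltnS => sN inv.
case: (leqP (size s) L) => sL; last first.
  exists s; split; [|exact: inv_uniq inv|exact: inv_sorted inv|exact: inv_fits inv].
  by apply/eqP; rewrite eqn_leq (inv_size inv) sL.
case: (pickP [pred u | [&& u \in U (c (size s)),
     u \notin visited s D (c (size s)) &
     (if s is v :: _ then e v u else true)]]) => [u /and3P[uU nv eu]|no].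
  have [inv' lt] := dfs_push inv sL uU nv eu.
  by apply: IH inv'; move: lt sN => /=; lia.
(* An empty stack can always be restarted, since the first class still has unvisited vertices. *)
case: s sN inv sL no => [|v s] sN inv sL no.
  have := unvisited_large (i := c 0) (inv_fits inv) (inv_size inv)
    (fun i' => ltnW (inv_small inv _ i')).
  move=> /(leq_trans m_gt0)/card_gt0P[u]; rewrite inE => /andP[nv uU].
  by have := no u; rewrite /= uU nv.
have [D' [inv' E]] : exists D', dfs_inv s D' /\ dfs_all s D' = dfs_all (v :: s) D.
  apply: dfs_pop => // u uU evu; apply/negPn/negP => nv.
  by have := no u; rewrite /= uU nv evu.
by apply: IH inv'; rewrite E; move: sN => /=; lia.
Qed.

Lemma dfs_path : exists p, [/\ size p = L.+1, uniq p, sorted e p &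
  forall x0 j, j <= L -> nth x0 p j \in U (c j)].
Proof.
have [|p [sp up ep fp]] := @dfs_run _ [::] (fun _ _ => set0) (ltnSn _).
  split=> //= [i i'|i i'|i i' x y]; first exact: sub0set.
    by rewrite cards0.
  by rewrite inE.
exists (rev p); split.
- by rewrite size_rev.
- by rewrite rev_uniq.
- by rewrite rev_sorted (eq_sorted (e' := e)) // => x y; rewrite e_sym.
- move=> x0 j jL; rewrite nth_rev ?sp ?ltnS // subSS.
  have : L - j < size p by lia.
  have : j = size p - (L - j).+1 by lia.
  move: (L - j) => k -> {j jL sp up ep}.
  elim: p k fp => //= v p IH [|k] /andP[vU fp] /=; first by rewrite subSS subn0.
  by rewrite ltnS subSS => kp; apply: IH.
Qed.

End DepthFirstSearch.

(** * Trees of exact depth *)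

Section SimplePaths.

Variables (T : finType) (e : rel T).
Implicit Types (Z : {set T}) (s u : T) (n : nat).

(** The parameter [n] counts vertices, not edges, so that it is additive under concatenation and the
    lengths of all pieces sum to the length of the cycle. *)
Definition upath Z s u n := exists p,
  [/\ path e s p, last s p = u, uniq (s :: p), size (s :: p) = n &
      {subset s :: p <= Z}].

Lemma upathS Z Z' s u n : Z \subset Z' -> upath Z s u n -> upath Z' s u n.
Proof.
move=> /subsetP ZZ [p [? ? ? ? pZ]]; exists p; split=> // x /pZ; exact: ZZ.
Qed.

Lemma upath_cat Z1 Z2 s u s' u' n1 n2 :
  [disjoint Z1 & Z2] -> upath Z1 s u n1 -> e u s' -> upath Z2 s' u' n2 ->
  upath (Z1 :|: Z2) s u' (n1 + n2).
Proof.
move=> dZ [p [ep lp up zp pZ]] eus [p' [ep' lp' up' zp' pZ']].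
exists (p ++ s' :: p'); split.
- by rewrite cat_path ep lp /= eus.
- by rewrite last_cat /= lp'.
- rewrite -cat_cons cat_uniq up up' andbT.
  apply/hasPn => x /pZ' xZ2; apply/negP => /pZ xZ1.
  by move/disjointFr: dZ => /(_ _ xZ1); rewrite xZ2.
- by rewrite -cat_cons size_cat zp zp'.
- move=> x; rewrite -cat_cons mem_cat in_setU => /orP[/pZ->//|/pZ'->].
  by rewrite orbT.
Qed.

Lemma upath_sym Z s u n : symmetric e -> upath Z s u n -> upath Z u s n.
Proof.
move=> es [p [ep lp up zp pZ]]; exists (rev (belast s p)).
have E : u :: rev (belast s p) = rev (s :: p) by rewrite [s :: p]lastI rev_rcons lp.
split; rewrite ?E.
- by rewrite -lp rev_path (eq_path (e' := e)) // => x y; rewrite es.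
- by rewrite -(last_cons u) E rev_cons last_rcons.
- by rewrite rev_uniq.
- by rewrite size_rev.
- by move=> x; rewrite mem_rev; apply: pZ.
Qed.

End SimplePaths.

Section Leaves.

Variables (T : finType) (e : rel T) (A B : {set T}) (q l m : nat).
Hypotheses (e_sym : symmetric e) (dAB : [disjoint A & B]).
Hypotheses (jAB : joined e m A B) (q_gt1 : 1 < q) (m_gt0 : 0 < m).
Hypotheses (ql_ge : m <= q ^ l) (ql_le : q ^ l <= q ^ 2 * m).
Hypotheses (capA : 4 * q * m * q.+2 + m <= #|A|).
Hypotheses (capB : 4 * q * m * q.+2 + m <= #|B|).

(** Restricting to edges across the pair makes the layers of a tree alternate between [A] and
    [B]. *)
Let f x y := e x y && ((x \in A) && (y \in B) || (x \in B) && (y \in A)).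
Let Z := A :|: B.
(** This is at least [2 * m], the threshold of [nbhd_fW], and at least [q * m], a bound for the last
    layer that has to be expanded. *)
Let K := 2 * q * m.

(** One side contains [m] vertices of [W], and their neighbourhood misses fewer than [m] vertices of
    the other side. *)
Let nbhd_fW (W : {set T}) : 2 * m <= #|W| -> W \subset Z ->
  4 * q * m * q.+2 < #|nbhd f W :\: W| + #|W|.
Proof.
move=> mW WZ.
suff side A' B' : joined e m A' B' -> 4 * q * m * q.+2 + m <= #|B'| ->
    (forall x y, x \in A' -> y \in B' -> e x y -> f x y) ->
    m <= #|W :&: A'| -> 4 * q * m * q.+2 < #|nbhd f W :\: W| + #|W|.
  have h : #|W| <= #|W :&: A| + #|W :&: B|.
    rewrite -{1}(setIidPl WZ) setIUr; exact: leq_cardsU.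
  case: (leqP m #|W :&: A|) => [mA|mA].
    apply: (side A B) => // x y xA yB exy.
    by rewrite /f exy xA yB.
  apply: (side B A) => //; last by lia.
    exact: joined_sym.
  by move=> x y xA yB exy; rewrite /f exy xA yB orbT.
move=> J cap fE mW'.
have h := joined_nbhd J (subsetIr _ _) mW'.
have h2 : #|B'| <= #|B' :\: nbhd e (W :&: A')| + #|nbhd f W :\: W| + #|W|.
  apply: (@leq_trans #|(B' :\: nbhd e (W :&: A')) :|: (nbhd f W :\: W) :|: W|).
    apply/subset_leq_card/subsetP => y yB; rewrite in_setU in_setU !in_setD yB andbT.
    case: (boolP (y \in W)) => yW; first by rewrite orbT.
    case: (boolP (y \in nbhd e _)) => //= /nbhdP[x]; rewrite inE => /andP[xW xA] exy.
    by rewrite orbF; apply/nbhdP; exists x => //; apply: fE.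
  apply: leq_trans (leq_cardsU _ _) _; rewrite leq_add2r; exact: leq_cardsU.
by lia.
Qed.

(* A maximal non-expanding set is small; outside it every small set expands. *)
Lemma expander_core : exists2 X : {set T}, X \subset Z /\ #|X| <= K &
  forall X' : {set T}, X' \subset Z :\: X -> 0 < #|X'| -> #|X'| <= K ->
  q.+1 * #|X'| < #|(nbhd f X' :\: X) :\: X'|.
Proof.
pose P (X : {set T}) := [&& X \subset Z, #|X| <= K &
   #|nbhd f X :\: X| <= q.+1 * #|X|].
have P0 : P set0.
  rewrite /P sub0set cards0 muln0 leqn0 cards_eq0 /=.
  apply/eqP/setP => y; rewrite !inE; apply/negbTE/negP => /exists_inP[x].
  by rewrite inE.
case: (arg_maxnP (fun X : {set T} => #|X|) P0) => X /and3P[XZ XK Xn] Xmax.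
exists X => // X' X'Z X'0 X'K; rewrite ltnNge; apply/negP => bad.
pose W := X :|: X'.
have X'X : [disjoint X & X'].
  rewrite disjoint_sym disjoints_subset; apply/subsetP => x /(subsetP X'Z).
  by rewrite !inE => /andP[].
have cW : #|W| = #|X| + #|X'|.
  by rewrite cardsU (disjoint_setI0 X'X) cards0 subn0.
have WZ : W \subset Z.
  by rewrite subUset XZ /=; apply: subset_trans X'Z (subsetDl _ _).
have nW : #|nbhd f W :\: W| <= q.+1 * #|W|.
  rewrite cW mulnDr; apply: leq_trans (leq_add Xn bad).
  apply: leq_trans (leq_cardsU _ _).
  apply/subset_leq_card/subsetP => y; rewrite !inE => /andP[].
  rewrite negb_or => /andP[-> ->] /exists_inP[x]; rewrite inE => /orP[xX|xX] fxy.
    by apply/orP; left; apply/exists_inP; exists x.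
  by apply/orP; right; apply/exists_inP; exists x.
(* The union is again non-expanding. If it is small, it contradicts maximality; otherwise its size
   lies between [K] and [2 * K], so together with its neighbours it has at most [q.+2 * (4 * q * m)]
   vertices, which is where the capacity hypothesis comes from. *)
case: (leqP #|W| K) => WK.
  have := Xmax W; rewrite /P WZ WK nW => /(_ isT); rewrite cW; lia.
have := nbhd_fW _ WZ; rewrite /K in WK *.
have : 2 * m <= #|W| by move: WK; nia.
move=> h /(_ h) h2.
have : #|W| <= 4 * q * m by rewrite cW; move: XK X'K; rewrite /K; lia.
by move: nW h2; nia.
Qed.

(** The tree grows by layers of exactly [q ^ k] vertices. Expansion by [q.+1] instead of [q] pays
    for the at most [q ^ k] vertices of earlier layers, which must be avoided; [ql_le] keeps every
    layer that is expanded below [K]. *)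
Lemma tree_leaves : exists2 A0 : {set T},
  A0 \subset A /\ #|A| <= #|A0| + 2 * q * m &
  forall x, x \in A0 -> exists2 S : {set T},
    S \subset (if odd l then B else A) /\ m <= #|S| &
    forall s, s \in S -> upath e Z s x l.+1.
Proof.
have [X [XZ XK] Xexp] := expander_core.
exists (A :\: X).
  split; first exact: subsetDl.
  rewrite -(cardsID X A) addnC leq_add2l; apply: leq_trans XK.
  exact/subset_leq_card/subsetIr.
move=> x; rewrite inE => /andP[xX xA].
suff layer k : k <= l -> exists S Y : {set T},
   [/\ S \subset Y, Y \subset Z :\: X, #|S| = q ^ k, #|Y| <= 2 * q ^ k &
      S \subset if odd k then B else A] /\ forall s, s \in S -> upath e Y s x k.+1.
  have [S [Y [[SY YZ cS _ SA] Sp]]] := layer l (leqnn l).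
  exists S; first by rewrite cS.
  move=> s /Sp; apply: upathS; apply: subset_trans YZ (subsetDl _ _).
elim: k => [|k IH] kl.
  exists [set x], [set x]; split.
    by rewrite subxx !cards1 expn0 !sub1set /= !inE xX xA.
  move=> s /set1P->; exists [::]; split=> // y; rewrite !inE //.
have [S [Y [[SY YZ cS cY SA] Sp]]] := IH (ltnW kl).
have q0 : 0 < q by lia.
have SK : #|S| <= K.
  rewrite cS /K; have : q ^ k.+1 <= q ^ 2 * m by apply: leq_trans ql_le; rewrite leq_exp2l.
  by rewrite expnS expnS expn1 -mulnA leq_pmul2l //; nia.
have S0 : 0 < #|S| by rewrite cS expn_gt0 q0.
pose N := (nbhd f S :\: X) :\: S.
have NB := Xexp S (subset_trans SY YZ) S0 SK; rewrite -/N in NB.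
have cYS : #|Y :\: S| <= q ^ k.
  by rewrite cardsD (setIidPr SY) cS; lia.
have NY : q ^ k.+1 <= #|N :\: Y|.
  have : #|N| <= #|N :\: Y| + #|Y :\: S|.
    apply: leq_trans (leq_cardsU _ _).
    apply/subset_leq_card/subsetP => y; rewrite !in_setU !in_setD.
    by case: (y \in Y) => //=; [move=> /andP[-> _]|move->].
  by rewrite expnS -cS in cYS *; nia.
have [S' S'N cS'] := subset_of_card NY.
have S'P s : s \in S' -> [/\ s \notin Y, s \notin X & exists2 s', s' \in S & f s' s].
  move=> /(subsetP S'N); rewrite in_setD => /andP[sY]; rewrite in_setD => /andP[_].
  by rewrite in_setD => /andP[sX /nbhdP[s' s'S fs]]; split=> //; exists s'.
exists S', (Y :|: S'); split; [split|].
- exact: subsetUr.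
- rewrite subUset YZ /=; apply/subsetP => s /S'P[_ sX [s' _ /andP[_ fs]]].
  by rewrite !inE sX /=; case/orP: fs => /andP[_ ->]; rewrite ?orbT.
- exact: cS'.
- apply: leq_trans (leq_cardsU _ _) _; rewrite cS' expnS.
  by move: cY; nia.
- apply/subsetP => s /S'P[_ _ [s' /(subsetP SA) s'A /andP[_ fs]]] /=.
  case: (odd k) s'A => /= s'A; case/orP: fs => /andP[h1 h2] //.
    by move/disjointFl: dAB => /(_ _ s'A); rewrite h1.
  by move/disjointFr: dAB => /(_ _ s'A); rewrite h1.
move=> s sS'; have [sY _ [s' /Sp [p [ep lp up zp pY]] /andP[es's _]]] := S'P s sS'.
exists (s' :: p); split=> //.
- by rewrite /= e_sym es's.
- by rewrite cons_uniq up andbT; apply: contra sY => /pY.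
- by rewrite /= -zp.
- move=> y; rewrite in_cons => /orP[/eqP->|/pY yY]; first by rewrite inE sS' orbT.
  by rewrite inE yY.
Qed.

End Leaves.

(** * Segments, links and closed chains *)

Section Segments.

Variables (T : finType) (e : rel T) (q l m c : nat).
Variables (Xa Ma Ya Xb Mb Yb : {set T}).
Hypothesis e_sym : symmetric e.
Let PA := Xa :|: Ma :|: Ya.
Let PB := Xb :|: Mb :|: Yb.
Hypotheses (dXa : [disjoint Xa & Ma :|: Ya]) (dMa : [disjoint Ma & Ya]).
Hypotheses (dXb : [disjoint Xb & Mb :|: Yb]) (dMb : [disjoint Mb & Yb]).
Hypotheses (dAB : [disjoint PA & PB]) (jAB : joined e m PA PB).
Hypotheses (q_gt1 : 1 < q) (m_gt0 : 0 < m) (l_even : ~~ odd l).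
Hypotheses (ql_ge : m <= q ^ l) (ql_le : q ^ l <= q ^ 2 * m).
Hypotheses (capXa : 4 * q * m * q.+2 + m <= #|Xa|).
Hypotheses (capXb : 4 * q * m * q.+2 + m <= #|Xb|).
Hypotheses (capYa : 4 * q * m * q.+2 + m <= #|Ya|).
Hypotheses (capYb : 4 * q * m * q.+2 + m <= #|Yb|).
Hypotheses (c_gt1 : 1 < c).
Hypotheses (capMa : c + 5 * m <= #|Ma|) (capMb : c + 5 * m <= #|Mb|).

(** The classes of the search: the first bit is the side of the pair, the second marks the two end
    positions, which must be roots of trees. Four classes account for the slack [5 * m]. *)
Let pat (j : nat) : bool * bool := (odd j, (j == 0) || (j == c.*2.-1)).

Let count_odd b k : count (fun j => odd j == b) (iota 0 k.*2) = k.
Proof.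
elim: k => // k IH; rewrite doubleS -addn2 iotaD count_cat IH /= addn0 add0n.
by rewrite odd_double /=; case: {IH} b => /=; lia.
Qed.

Let count_pat i : count (fun j => pat j == i) (iota 0 c.*2) <=
  if i.2 then 1 else c.
Proof.
case: i => b [] /=; last first.
  rewrite -[X in _ <= X](count_odd b); apply: sub_count => j /=.
  by rewrite xpair_eqE => /andP[].
apply: (@leq_trans (count_mem (if b then c.*2.-1 else 0) (iota 0 c.*2)));
  last by rewrite count_uniq_mem ?iota_uniq // leq_b1.
apply: sub_count => j /=; rewrite xpair_eqE eqb_id => /andP[/eqP <-].
move=> /orP[/eqP->|/eqP->]; first by [].
by case: (c) c_gt1 => // k _; rewrite doubleS /= odd_double.
Qed.

Lemma main_path (A0 B0 : {set T}) : A0 \subset Xa -> B0 \subset Yb ->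
  1 + 5 * m <= #|A0| -> 1 + 5 * m <= #|B0| ->
  exists x y a b, [/\ x \in A0, y \in B0, e x a, e b y &
    upath e (Ma :|: Mb) a b (c.*2.-2)].
Proof.
move=> sA sB cA cB.
pose U (i : bool * bool) := match i with
  | (false, true) => A0 | (false, false) => Ma
  | (true, false) => Mb | (true, true) => B0 end.
have UA b : U (false, b) \subset PA.
  by case: b => /=; rewrite /PA; [apply: subset_trans sA _|];
    apply/subsetP => x; rewrite !inE => ->; rewrite ?orbT.
have UB b : U (true, b) \subset PB.
  by case: b => /=; rewrite /PB; [apply: subset_trans sB _|];
    apply/subsetP => x; rewrite !inE => ->; rewrite ?orbT.
have UAB x b b' : x \in U (false, b) -> x \in U (true, b') -> False.
  move=> /(subsetP (UA _)) xA /(subsetP (UB _)) xB.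
  by move/disjointFr: dAB => /(_ _ xA); rewrite xB.
have AM x : x \in A0 -> x \in Ma -> False.
  move=> /(subsetP sA) xA xM; move/disjointFr: dXa => /(_ _ xA).
  by rewrite inE xM.
have BM x : x \in B0 -> x \in Mb -> False.
  move=> /(subsetP sB) xB xM; move/disjointFr: dMb => /(_ _ xM).
  by rewrite xB.
have Ud i i' x : x \in U i -> x \in U i' -> i = i'.
  move: i i' => [[] b] [[] b'] // h h'.
  - move: b b' h h' => [] [] //= h h'; case: (BM x) => //.
  - by case: (UAB x b' b).
  - by case: (UAB x b b').
  - move: b b' h h' => [] [] //= h h'; case: (AM x) => //.
have c2 : c.*2.-1.+1 = c.*2 by clear -c_gt1; lia.
have [||p [sp up ep pU]] := @dfs_path T e _ U pat c.*2.-1 m e_sym Ud m_gt0.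
- move=> j _; rewrite /pat /=; case: (odd j) => /=.
    by apply: joined_sym => //; apply: joinedS (UA _) (UB _) jAB.
  exact: joinedS (UA _) (UB _) jAB.
- move=> i; rewrite card_prod card_bool c2.
  apply: (@leq_trans ((if i.2 then 1 else c) + 5 * m)).
    by rewrite leq_add2r count_pat.
  by case: i => [[] []].
rewrite c2 in sp; have c4 : 3 < c.*2 by clear -c_gt1; lia.
case: p sp up ep pU => [|x p] sp up ep pU; first by rewrite -sp in c4.
case/lastP: p sp up ep pU => [|p y] sp up ep pU; first by rewrite -sp in c4.
case: p sp up ep pU => [|a p] sp up ep pU; first by rewrite -sp in c4.
have zp : (size p).+3 = c.*2 by rewrite -sp /= size_rcons.
move: ep; rewrite /= rcons_path => /and3P[exa ep eby].
exists x, y, a, (last a p); split=> //.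
- by have := pU x 0 (leq0n _); rewrite /pat /=.
- have := pU x c.*2.-1 (leqnn _).
  have -> : nth x (x :: rcons (a :: p) y) c.*2.-1 = y.
    by rewrite -zp /= nth_rcons ltnn eqxx.
  by rewrite /pat eqxx orbT -zp /= -[~~ odd _]/(odd (size p).+1) -[odd _]negbK
     -[~~ odd _]/(odd (size p).+2) -[~~ odd _]/(odd (size p).+3) zp odd_double.
exists p; split=> //.
- move: up; rewrite cons_uniq rcons_uniq => /and3P[_ _ ->] //.
- by rewrite /= -zp.
move=> v vp; pose k := index v (a :: p).
have kp : k < (size p).+1 by rewrite -[(size p).+1]/(size (a :: p)) index_mem.
have := pU x k.+1; have -> : nth x (x :: rcons (a :: p) y) k.+1 = v.
  by rewrite /= -rcons_cons nth_rcons /= kp nth_index.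
move=> /(_ _); rewrite -ltnS c2 -zp => H.
have {H} : v \in U (pat k.+1) by apply: H; clear -kp; lia.
have -> : pat k.+1 = (odd k.+1, false).
  rewrite /pat -zp; congr (_, _); apply/negbTE; rewrite negb_or /=.
  by rewrite eqSS neq_ltn kp.
by rewrite inE; case: (odd _) => /= ->; rewrite ?orbT.
Qed.

(** A link chooses its own end vertices inside large sets, so a segment must work for all of them
    with one common number of vertices. *)
Definition robust (S E Z : {set T}) n :=
  forall s u, s \in S -> u \in E -> upath e Z s u n.

(** The two trees and the path lie in the disjoint X, Y and M parts. Since [l] is even, the leaves
    lie on the side of the root: starts in the first block, ends in the second. *)
Lemma robust_segment : exists S E : {set T},
  [/\ S \subset Xa, m <= #|S|, E \subset Yb, m <= #|E| &
      robust S E (PA :|: PB) (l.*2 + c.*2)].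
Proof.
have sXaA : Xa \subset PA by rewrite /PA -setUA subsetUl.
have sYaA : Ya \subset PA by rewrite /PA subsetUr.
have sMaA : Ma \subset PA by rewrite /PA setUAC subsetUr.
have sXbB : Xb \subset PB by rewrite /PB -setUA subsetUl.
have sYbB : Yb \subset PB by rewrite /PB subsetUr.
have sMbB : Mb \subset PB by rewrite /PB setUAC subsetUr.
have dsub (A A' B B' : {set T}) : [disjoint A & B] -> A' \subset A ->
    B' \subset B -> [disjoint A' & B'].
  by move=> d sA sB; apply: disjointWl sA (disjointWr sB d).
have dX : [disjoint Xa & Xb] by apply: dsub dAB _ _.
have dY : [disjoint Yb & Ya] by rewrite disjoint_sym; apply: dsub dAB _ _.
have jX : joined e m Xa Xb by apply: joinedS jAB.
have jY : joined e m Yb Ya by apply: joined_sym => //; apply: joinedS jAB.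
have [A0 [sA0 cA0] HA] := tree_leaves e_sym dX jX q_gt1 m_gt0 ql_ge ql_le capXa capXb.
have [B0 [sB0 cB0] HB] := tree_leaves e_sym dY jY q_gt1 m_gt0 ql_ge ql_le capYb capYa.
rewrite (negbTE l_even) in HA HB.
have [||x [y [a [b [xA yB exa eby pab]]]]] := main_path sA0 sB0.
- by clear -cA0 capXa q_gt1 m_gt0; nia.
- by clear -cB0 capYb q_gt1 m_gt0; nia.
have [S [sS mS] HS] := HA x xA; have [E [sE mE] HE] := HB y yB.
exists S, E; split=> // s u sS' uE.
have mem_dis (A B : {set T}) : [disjoint A & B] -> forall v, (v \in A) && (v \in B) = false.
  by move=> d v; apply/negbTE/negP => /andP[vA vB]; move/disjointFr: d => /(_ _ vA); rewrite vB.
have dis v := (mem_dis _ _ dAB v, mem_dis _ _ dXa v, mem_dis _ _ dMa v,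
  mem_dis _ _ dXb v, mem_dis _ _ dMb v).
have d1 : [disjoint Xa :|: Xb & Ma :|: Mb].
  rewrite -setI_eq0; apply/eqP/setP => v; have := dis v; rewrite !inE.
  by case: (v \in Xa); case: (v \in Ma); case: (v \in Xb); case: (v \in Mb);
    rewrite /= ?orbT ?andbT => [[[[[]]]]].
have d2 : [disjoint (Xa :|: Xb) :|: (Ma :|: Mb) & Yb :|: Ya].
  rewrite -setI_eq0; apply/eqP/setP => v; have := dis v; rewrite !inE.
  by case: (v \in Xa); case: (v \in Ma); case: (v \in Xb); case: (v \in Mb);
    case: (v \in Ya); case: (v \in Yb); rewrite /= ?orbT ?andbT => [[[[[]]]]].
have p1 := upath_cat d1 (HS s sS') exa pab.
have := upath_cat d2 p1 eby (upath_sym e_sym (HE u uE)).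
have -> : l.+1 + c.*2.-2 + l.+1 = l.*2 + c.*2 by clear -c_gt1; lia.
apply: upathS; rewrite !subUset; apply/andP; split; first (apply/andP; split).
- by rewrite (subset_trans sXaA) ?(subset_trans sXbB) ?subsetUl ?subsetUr.
- by rewrite (subset_trans sMaA) ?(subset_trans sMbB) ?subsetUl ?subsetUr.
- by rewrite (subset_trans sYaA) ?(subset_trans sYbB) ?subsetUl ?subsetUr.
Qed.

End Segments.

Section Links.

Variables (T : finType) (e : rel T).
Implicit Types (S E Z W : {set T}).

Lemma upath_link Z1 Z2 s u s' u' n1 n2 (p : seq T) :
  upath e Z1 s u n1 -> path e u (rcons p s') -> upath e Z2 s' u' n2 ->
  uniq p -> [disjoint Z1 & Z2] ->
  (forall x, x \in p -> x \notin Z1 /\ x \notin Z2) ->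
  upath e (Z1 :|: Z2 :|: [set x in p]) s u' (n1 + size p + n2).
Proof.
move=> [p1 [ep1 lp1 up1 zp1 pZ1]] ep [p2 [ep2 lp2 up2 zp2 pZ2]] up dZ pZ.
exists (p1 ++ rcons p s' ++ p2); split.
- by rewrite cat_path ep1 lp1 cat_path ep last_rcons.
- by rewrite last_cat lp1 last_cat last_rcons.
- rewrite -cat_cons cat_uniq up1 cat_rcons cat_uniq up up2 !andTb andbT.
  apply/andP; split; apply/hasPn => x.
    rewrite mem_cat => /orP[/pZ[nx _]|/pZ2 xZ2]; apply/negP => /pZ1 xZ1.
      by rewrite xZ1 in nx.
    by move/disjointFr: dZ => /(_ _ xZ1); rewrite xZ2.
  by move=> /pZ2 xZ2; apply/negP => /pZ[_]; rewrite xZ2.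
- rewrite -cat_cons size_cat zp1 cat_rcons size_cat zp2; lia.
- move=> x; rewrite -cat_cons mem_cat cat_rcons mem_cat !in_setU in_set.
  by move=> /or3P[/pZ1->|->|/pZ2->]; rewrite ?orbT.
Qed.

Variables (J : finType) (R : rel J) (P : J -> {set T}) (m : nat).
Variable Lk : J * bool -> {set T}.
Hypothesis RJ : forall i j, R i j -> joined e m (P i) (P j).
Hypothesis LkP : forall w, Lk w \subset P w.1.
Hypothesis Lk_disj : forall w w' x, x \in Lk w -> x \in Lk w' -> w = w'.

(** The bipartite double cover of [R]: the levels of its vertices record the parity of a walk. *)
Definition dbl (u v : J * bool) := R u.1 v.1 && (u.2 != v.2).

(** Sets are propagated instead of vertices: among the free vertices of the next reservoir, the
    neighbours of the current set still number at least [m]. Only when [S] is reached is an edge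
    fixed, and the path is then read off backwards. *)
Lemma link_sets W ws u0 v E S :
  path dbl u0 (rcons ws v) -> uniq ws ->
  E \subset P u0.1 -> m <= #|E| -> S \subset P v.1 -> m <= #|S| ->
  (forall w, w \in ws -> 2 * m <= #|Lk w :\: W|) ->
  exists u s p, [/\ u \in E, s \in S, path e u (rcons p s) & size p = size ws]
    /\ [/\ uniq p & forall x, x \in p -> x \notin W /\ exists2 w, w \in ws & x \in Lk w].
Proof.
move=> + + + + sS mS; elim: ws u0 E => [|w ws IH] u0 E.
  rewrite /= andbT => /andP[/RJ/joinedP J0 _] _ sE mE _.
  by have [u [s [uE sS' eus]]] := J0 _ _ sE sS mE mS; exists u, s, [::]; rewrite /= eus.
rewrite rcons_cons /= => /andP[/andP[/RJ J0 _] pw] /andP[wws uws] sE mE cW.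
have h := joined_nbhd J0 sE mE.
pose N := (Lk w :\: W) :&: nbhd e E.
have NP : N \subset P w.1.
  by apply: subset_trans (subsetIl _ _) _; apply: subset_trans (subsetDl _ _) (LkP w).
have mN : m <= #|N|.
  have := cW w (mem_head _ _); rewrite -(cardsID (nbhd e E) (Lk w :\: W)) -/N.
  have : #|(Lk w :\: W) :\: nbhd e E| <= #|P w.1 :\: nbhd e E|.
    apply: subset_leq_card; apply: setSD.
    exact: subset_trans (subsetDl _ _) (LkP w).
  by lia.
have [|u' [s [p [[uN sS' ep zp] [up pW]]]]] := IH w N pw uws NP mN.
  by move=> w' w'ws; apply: cW; rewrite inE w'ws orbT.
move: uN; rewrite inE in_setD => /andP[/andP[u'W u'L] /nbhdP[u uE euu']].
exists u, s, (u' :: p); split; first by split; rewrite //= ?zp // euu'.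
split=> [|x].
  rewrite /= up andbT; apply/negP => /pW[_ [w' w'ws u'L']].
  by move: wws; rewrite (Lk_disj u'L u'L') w'ws.
rewrite inE => /orP[/eqP->|/pW[xW [w' w'ws xL]]].
  by split=> //; exists w; rewrite ?mem_head.
by split=> //; exists w' => //; rewrite inE w'ws orbT.
Qed.

Variables (Sg Eg Zg : J * J -> {set T}) (N : J * J -> nat).
Variables (ws : J * J -> J * J -> seq (J * bool)) (K : nat).
Implicit Types (p : J * J) (ps : seq (J * J)).

Definition lks : {set T} := \bigcup_w Lk w.

Fixpoint chain_len p ps : nat :=
  if ps is p' :: ps' then N p + size (ws p p') + chain_len p' ps' else N p.

Definition chain_zone p ps : {set T} := \bigcup_(p' <- p :: ps) Zg p'.

Lemma robust_chain p0 ps :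
  uniq (p0 :: ps) ->
  (forall p, p \in p0 :: ps -> [/\ robust e (Sg p) (Eg p) (Zg p) (N p),
    Sg p \subset P p.1, Eg p \subset P p.2, m <= #|Sg p| /\ m <= #|Eg p| &
    [disjoint Zg p & lks]]) ->
  (forall p p', p \in p0 :: ps -> p' \in p0 :: ps -> p != p' ->
     [disjoint Zg p & Zg p'] /\
     [/\ path dbl (p.2, true) (rcons (ws p p') (p'.1, false)), uniq (ws p p') &
         size (ws p p') <= K]) ->
  (forall w, 2 * m + size ps * K <= #|Lk w|) ->
  exists V : {set T}, [/\ V \subset lks, #|V| <= size ps * K &
   robust e (Sg p0) (Eg (last p0 ps)) (chain_zone p0 ps :|: V) (chain_len p0 ps)].
Proof.
elim: ps p0 => [|p1 ps IH] p0 ups segs wss cap.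
  exists set0; split; rewrite ?sub0set ?cards0 //.
  rewrite /chain_zone big_seq1 setU0 /=.
  by have [] := segs p0 (mem_head _ _).
have [||||V [VL cV rV]] := IH p1.
- by move: ups => /= /andP[].
- by move=> p pin; apply: segs; rewrite inE pin orbT.
- by move=> p p' pin p'in; apply: wss; rewrite inE ?pin ?p'in orbT.
- move=> w; apply: leq_trans (cap w); rewrite leq_add2l /= leq_mul2r leqnSn orbT //.
have [r0 _ sE0 [_ mE0] dZ0] := segs p0 (mem_head _ _).
have p1in : p1 \in [:: p0, p1 & ps] by rewrite !inE eqxx orbT.
have [_ sS1 _ [mS1 _] _] := segs p1 p1in.
have p01 : p0 != p1 by move: ups; rewrite /= inE negb_or -andbA => /and3P[].
have [dZ01 [pw uw zw]] := wss p0 p1 (mem_head _ _) p1in p01.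
have [w _|u [s [p [[uE sS ep zp] [up pV]]]]] := link_sets (W := V) pw uw sE0 mE0 sS1 mS1.
  rewrite cardsD; have := subset_leq_card (subsetIr (Lk w) V).
  by have := cap w; rewrite /= mulSn; move: cV; lia.
have pL x : x \in p -> x \in lks.
  by move=> /pV[_ [w _ xL]]; apply/bigcupP; exists w.
have chainL : [disjoint chain_zone p1 ps & lks].
  rewrite disjoint_sym disjoints_subset; apply/subsetP => x xL; rewrite inE.
  rewrite /chain_zone bigcup_seq; apply/negP => /bigcupP[p' p'in xZ].
  have [_ _ _ _ d] := segs p' (mem_behead (s := p0 :: p1 :: ps) p'in).
  by move/disjointFr: d => /(_ _ xZ); rewrite xL.
exists (V :|: [set x in p]); split.
- by rewrite subUset VL; apply/subsetP => x; rewrite inE; apply: pL.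
- apply: leq_trans (leq_cardsU _ _) _; rewrite /= mulSn addnC leq_add //.
  by rewrite cardsE; apply: leq_trans (card_size _) _; rewrite zp.
move=> s0 u0 s0S u0E /=.
have := upath_link (r0 s0 u s0S uE) ep (rV s u0 sS u0E) up.
rewrite zp => H; apply: upathS (H _ _).
- have -> : chain_zone p0 (p1 :: ps) = Zg p0 :|: chain_zone p1 ps.
    by rewrite /chain_zone big_cons.
  by rewrite !setUA.
- rewrite disjoint_sym disjoints_subset subUset -!disjoints_subset.
  apply/andP; split; last first.
    by apply: disjointWl VL _; rewrite disjoint_sym.
  rewrite disjoint_sym disjoints_subset; apply/subsetP => x xZ0; rewrite inE.
  rewrite /chain_zone bigcup_seq; apply/negP => /bigcupP[p' p'in xZ].
  have p'in' := mem_behead (s := p0 :: p1 :: ps) p'in.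
  have [|d _] := wss p0 p' (mem_head _ _) p'in'.
    by apply: contraTneq p'in => <-; move: ups => /= /andP[].
  by move/disjointFr: d => /(_ _ xZ0); rewrite xZ.
- move=> x xp; have xL := pL x xp; have [xV _] := pV x xp; split.
    by move/disjointFl: dZ0 => /(_ _ xL)->.
  by rewrite inE negb_or xV andbT; move/disjointFl: chainL => /(_ _ xL)->.
Qed.

(** Since the chain works for every start and every end, the closing link may choose them. Its
    target level [b] is left free because it determines the parity of the cycle. *)
Lemma close_chain p0 ps wc b :
  uniq (p0 :: ps) ->
  (forall p, p \in p0 :: ps -> [/\ robust e (Sg p) (Eg p) (Zg p) (N p),
    Sg p \subset P p.1, Eg p \subset P p.2, m <= #|Sg p| /\ m <= #|Eg p| &
    [disjoint Zg p & lks]]) ->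
  (forall p p', p \in p0 :: ps -> p' \in p0 :: ps -> p != p' ->
     [disjoint Zg p & Zg p'] /\
     [/\ path dbl (p.2, true) (rcons (ws p p') (p'.1, false)), uniq (ws p p') &
         size (ws p p') <= K]) ->
  path dbl ((last p0 ps).2, true) (rcons wc (p0.1, b)) -> uniq wc ->
  (forall w, 2 * m + size ps * K <= #|Lk w|) ->
  exists c, size c = chain_len p0 ps + size wc /\ ucycle e c.
Proof.
move=> ups segs wss pwc uwc cap.
have [V [VL cV rV]] := robust_chain ups segs wss cap.
have [_ sS0 _ [mS0 _] _] := segs p0 (mem_head _ _).
have [_ _ sEl [_ mEl] _] := segs (last p0 ps) (mem_last _ _).
have [w _|u [s [p [[uE sS ep zp] [up pV]]]]] :=
    link_sets (W := V) pwc uwc sEl mEl sS0 mS0.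
  rewrite cardsD; have := subset_leq_card (subsetIr (Lk w) V).
  by have := cap w; move: cV; lia.
have [p' [ep' lp' up' zp' pZ']] := rV s u sS uE.
exists (s :: p' ++ p); split; first by rewrite -cat_cons size_cat zp' zp.
apply/andP; split.
  by rewrite /= rcons_cat cat_path ep' lp'.
rewrite -cat_cons cat_uniq up' up andbT; apply/hasPn => x xp.
apply/negP => /pZ'; have [xV [w _ xw]] := pV x xp.
have xL : x \in lks by apply/bigcupP; exists w.
rewrite inE (negbTE xV) orbF /chain_zone bigcup_seq => /bigcupP[p1 p1in xZ].
by have [_ _ _ _ d] := segs p1 p1in; move/disjointFr: d => /(_ _ xZ); rewrite xL.
Qed.

End Links.

Lemma disjoint_pieces (T : finType) (ns : seq nat) (A : {set T}) :
  sumn ns <= #|A| -> exists f : nat -> {set T}, forall i, i < size ns ->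
    [/\ f i \subset A, #|f i| = nth 0 ns i &
        forall i', i' < size ns -> i != i' -> [disjoint f i & f i']].
Proof.
elim: ns A => [|n ns IH] A /=; first by move=> _; exists (fun _ => set0).
move=> nA; have [|B BA cB] := @subset_of_card _ A n; first by lia.
have [|f fP] := IH (A :\: B).
  by rewrite cardsD (setIidPr BA) cB; lia.
have fB i : i < size ns -> [disjoint B & f i].
  move=> /fP[fA _ _]; rewrite disjoint_sym disjoints_subset.
  by apply: subset_trans fA _; rewrite setDE subsetIr.
exists (fun i => if i is i'.+1 then f i' else B) => -[|i] /=.
  move=> _; split=> // -[|i'] //= lt _; exact: fB.
rewrite ltnS => lt; have [fA cf fd] := fP i lt; split=> //.
  exact: subset_trans fA (subsetDl _ _).
move=> [|i'] //= lt' ne; first by rewrite disjoint_sym; apply: fB.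
exact: fd.
Qed.

Lemma distribute (X : eqType) (s : seq X) lo hi Q : uniq s -> lo <= hi ->
  lo * size s <= Q <= hi * size s ->
  exists f : X -> nat, (forall x, lo <= f x <= hi) /\ \sum_(x <- s) f x = Q.
Proof.
move=> + lohi; elim: s Q => [|x s IH] Q /=.
  by rewrite !muln0 leqn0 => _ /eqP->; exists (fun _ => lo); rewrite big_nil leqnn.
move=> /andP[xs us]; rewrite !mulnS => /andP[h1 h2].
(* The first entry takes as much as possible while [lo] is kept for each of the others. *)
pose v := minn hi (Q - lo * size s).
have lohis : lo * size s <= hi * size s by rewrite leq_mul2r lohi orbT.
have [|f [fb fs]] := IH (Q - v) us; first by rewrite /v; lia.
exists (fun y => if y == x then v else f y); split.
  move=> y; case: eqP => // _; rewrite /v; lia.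
rewrite big_cons eqxx (eq_big_seq f); first by rewrite fs /v; lia.
by move=> y ys; case: eqP ys => // ->; rewrite (negbTE xs).
Qed.

Section Walks.

Variables (J : finType) (R : rel J).

Lemma dbl_path_parity u p : path (dbl R) u p ->
  (last u p).2 = u.2 (+) odd (size p).
Proof.
elim: p u => [|v p IH] u /=; first by rewrite addbF.
move=> /andP[/andP[_ uv] /IH ->]; move: uv.
by case: u.2; case: v.2; case: (odd _).
Qed.

Lemma connect_walk u v : connect (dbl R) u v -> u != v -> exists ws,
  [/\ path (dbl R) u (rcons ws v), uniq ws, size ws <= 2 * #|J| &
      odd (size ws) = (u.2 == v.2)].
Proof.
move=> /connectP[p ep ->]; case/shortenP: ep => p' ep' up' _ ne.
case/lastP: p' ep' up' ne => [|ws w]; first by rewrite /= eqxx.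
rewrite last_rcons => ep' up' _; exists ws; split=> //.
- by move: up'; rewrite /= rcons_uniq => /and3P[].
- have := max_card (mem (u :: rcons ws w)).
  rewrite (card_uniqP up') /= size_rcons card_prod card_bool mulnC => h.
  by do 2 apply: ltnW.
- have := dbl_path_parity ep'; rewrite last_rcons size_rcons /= => ->.
  by case: u.2; case: (odd _).
Qed.

End Walks.

(** * A cycle of exact length along a matching of the reduced graph *)

Section Embedding.

Variables (T : finType) (e : rel T) (J : finType) (R : rel J).
Variables (P : J -> {set T}) (p0 : J * J) (ps : seq (J * J)) (m q l z c t : nat).
Let pps := p0 :: ps.
Let r := size pps.
Hypothesis e_sym : symmetric e.
Hypothesis P_disj : forall i j x, x \in P i -> x \in P j -> i = j.
Hypothesis RJ : forall i j, R i j -> joined e m (P i) (P j).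
Hypothesis pps_uniq : uniq pps.
Hypothesis pps1 : {in pps &, forall p p', p.1 = p'.1 -> p = p'}.
Hypothesis pps2 : {in pps &, forall p p', p.2 = p'.2 -> p = p'}.
Hypothesis pps12 : {in pps &, forall p p', p.1 != p'.2}.
Hypothesis ppsR : {in pps, forall p, R p.1 p.2}.
Hypothesis pps_conn : {in pps &, forall p p',
  connect (dbl R) (p.2, true) (p'.1, false)}.
Hypothesis pps_conn_odd : odd t -> {in pps &, forall p p',
  connect (dbl R) (p.2, true) (p'.1, true)}.
Hypotheses (m_gt0 : 0 < m) (q_gt1 : 1 < q) (l_even : ~~ odd l).
Hypotheses (ql_ge : m <= q ^ l) (ql_le : q ^ l <= q ^ 2 * m).
Hypothesis z_tree : 4 * q * m * q.+2 + m <= z.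
Hypothesis z_link : 2 * m + r * (2 * #|J|) <= z.
Hypothesis P_large : forall j, 4 * z + (c + 5 * m) <= #|P j|.
Hypothesis t_ge : r * (2 * l + 4 + 2 * #|J|) <= t.
Hypothesis t_le : t <= 2 * c * r.

Theorem cycle_of_matching : exists s, size s = t /\ ucycle e s.
Proof.
pose K := 2 * #|J|.
(* Pieces 0 and 1 hold the trees at the two ends, pieces 2 and 3 are the link reservoirs for the two
   levels, and piece 4 holds the long path. *)
have /fin_all_exists[Z ZP] (j : J) : exists f : nat -> {set T}, forall i, i < 5 ->
    [/\ f i \subset P j, #|f i| = nth 0 [:: z; z; z; z; c + 5 * m] i &
        forall i', i' < 5 -> i != i' -> [disjoint f i & f i']].
  by apply: (@disjoint_pieces _ [:: z; z; z; z; c + 5 * m]);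
     rewrite /= addn0; have := P_large j; clear; lia.
have Zinj j i j' i' x : i < 5 -> i' < 5 -> x \in Z j i -> x \in Z j' i' ->
    j = j' /\ i = i'.
  move=> i5 i'5 xZ xZ'; have [sP _ _] := ZP j i i5; have [sP' _ _] := ZP j' i' i'5.
  have E := P_disj (subsetP sP _ xZ) (subsetP sP' _ xZ').
  split=> //; apply/eqP/negPn/negP => ne; rewrite -E in xZ'.
  have [_ _ /(_ i' i'5 ne)] := ZP j i i5.
  by move=> /disjointFr/(_ xZ); rewrite xZ'.
have Zdis j i j' i' : i < 5 -> i' < 5 -> (j != j') || (i != i') ->
    [disjoint Z j i & Z j' i'].
  move=> i5 i'5 ne; rewrite -setI_eq0; apply/eqP/setP => x; rewrite !inE.
  apply/negbTE/negP => /andP[h h']; have [E E'] := Zinj _ _ _ _ _ i5 i'5 h h'.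
  by move: ne; rewrite E E' !eqxx.
pose Lk (w : J * bool) := Z w.1 (2 + w.2).
have b5 (b : bool) : 2 + b < 5 by case: b.
have LkP w : Lk w \subset P w.1 by have [] := ZP w.1 (2 + w.2) (b5 _).
have cLk w : #|Lk w| = z by have [_ ->] := ZP w.1 (2 + w.2) (b5 _); case: (w.2).
have Lkd w w' x : x \in Lk w -> x \in Lk w' -> w = w'.
  move: w w' => [j b] [j' b'] h h'.
  by have [/= -> /eqP] := Zinj _ _ _ _ _ (b5 _) (b5 _) h h'; case: b {h}; case: b' {h'}.
have /fin_all_exists[ws wsP] (pp : (J * J) * (J * J)) :
    exists ws : seq (J * bool), pp.1 \in pps -> pp.2 \in pps ->
    [/\ path (dbl R) (pp.1.2, true) (rcons ws (pp.2.1, false)),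
        uniq ws, size ws <= K & ~~ odd (size ws)].
  case: pp => p p' /=.
  case: (boolP (p \in pps)) => pin; last by exists [::].
  case: (boolP (p' \in pps)) => p'in; last by exists [::].
  have [|ws [? ? ? o]] := connect_walk (pps_conn pin p'in).
    by rewrite xpair_eqE andbF.
  by exists ws => _ _; split=> //; rewrite o.
have p0in : p0 \in pps by rewrite mem_head.
have lastin : last p0 ps \in pps by rewrite mem_last.
(* All segments and inner links have an even number of vertices, so the closing link alone must have
   the parity of [t]. *)
have [wc [pwc uwc zwc owc]] : exists wc : seq (J * bool),
   [/\ path (dbl R) ((last p0 ps).2, true) (rcons wc (p0.1, odd t)), uniq wc,
       size wc <= K & odd (size wc) = odd t].
  case: (boolP (odd t)) => ot; last first.
    have [h1 h2 h3 /negbTE h4] := wsP (last p0 ps, p0) lastin p0in.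
    by exists (ws (last p0 ps, p0)).
  have [|wc [? ? ? o]] := connect_walk (pps_conn_odd ot lastin p0in).
    by rewrite xpair_eqE eqxx andbT eq_sym pps12.
  by exists wc.
pose wsf p p' := ws (p, p').
pose link_len := (fix f p ps := if ps is p' :: ps' then
  size (wsf p p') + f p' ps' else 0) p0 ps.
have chainE N : chain_len N wsf p0 ps = \sum_(p <- pps) N p + link_len.
  rewrite /link_len /pps; elim: (ps) (p0) => [|p' s IH] p /=.
    by rewrite big_seq1 addn0.
  by rewrite IH [in RHS]big_cons -!addnA [size _ + (_ + _)]addnCA.
have [link_le link_even] : link_len <= size ps * K /\ ~~ odd link_len.
  have : {subset pps <= pps} by [].
  rewrite /link_len {1}/pps.
  elim: (ps) (p0) => [|p' s IH] p sub //=.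
  have pin : p \in pps by apply: sub; rewrite mem_head.
  have p'in : p' \in pps by apply: sub; rewrite !inE eqxx orbT.
  have [_ _ h1 h2] := wsP (p, p') pin p'in.
  have [|h3 h4] := IH p'; first by move=> x xin; apply: sub; rewrite inE xin orbT.
  by rewrite oddD (negbTE h2) (negbTE h4) mulSn leq_add.
have rE : r = (size ps).+1 by [].
pose W := link_len + size wc.
have W_le : W <= r * K by rewrite rE mulSn addnC leq_add.
have oW : odd W = odd t by rewrite oddD (negbTE link_even) owc.
have tE : r * (2 * l + 4 + K) <= t by [].
have [f [fb fs]] : exists f : J * J -> nat, (forall p, 2 <= f p <= c) /\
    \sum_(p <- pps) f p = (t - W)./2 - r * l.
  have even : odd (t - W) = false.
    rewrite oddB ?oW ?addbb //; apply: leq_trans W_le _; apply: leq_trans tE.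
    by rewrite leq_mul2l; apply/orP; right; clear; lia.
  have halfE : (t - W)./2 * 2 = t - W.
    by rewrite muln2 -[RHS]odd_double_half even.
  apply: distribute => //; first by move: tE t_le; rewrite rE; clear; nia.
  rewrite -/r; move: halfE; move: (t - W)./2 => H halfE.
  apply/andP; split; first by clear -halfE tE W_le; nia.
  clear -halfE tE W_le t_le; nia.
have /fin_all_exists[SE SEP] (p : J * J) :
   exists SE : {set T} * {set T}, p \in pps ->
   [/\ robust e SE.1 SE.2 (Z p.1 0 :|: Z p.1 4 :|: Z p.1 1 :|:
        (Z p.2 0 :|: Z p.2 4 :|: Z p.2 1)) (l.*2 + (f p).*2),
       SE.1 \subset P p.1, SE.2 \subset P p.2 &
       m <= #|SE.1| /\ m <= #|SE.2|].
  case: (boolP (p \in pps)) => pin; last by exists (set0, set0).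
  have p12 : p.1 != p.2 by apply: pps12.
  have sub j i : i < 5 -> Z j i \subset P j by move=> i5; have [] := ZP j i i5.
  have cz j i : i < 2 -> #|Z j i| = z.
    move=> i2; have i5 : i < 5 by apply: leq_trans i2 _.
    by have [_ -> _] := ZP j i i5; case: (i) i2 => [|[]].
  have cM j : #|Z j 4| = c + 5 * m by have [_ -> _] := ZP j 4 isT.
  have dU (A B C : {set T}) : [disjoint A & B] -> [disjoint A & C] -> [disjoint A & B :|: C].
    by rewrite ![[disjoint A & _]]disjoint_sym !disjoints_subset subUset => -> ->.
  have PP j : Z j 0 :|: Z j 4 :|: Z j 1 \subset P j by rewrite !subUset !sub.
  have jAB := joinedS (PP p.1) (PP p.2) (RJ (ppsR pin)).
  have /andP[f2 fc] := fb p.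
  have [||||||||||||S [E [sS mS sE mE rob]]] :=
    @robust_segment T e q l m (f p) (Z p.1 0) (Z p.1 4) (Z p.1 1)
      (Z p.2 0) (Z p.2 4) (Z p.2 1) e_sym _ _ _ _ _ jAB q_gt1 m_gt0 l_even ql_ge ql_le.
  all: try by [].
  all: rewrite ?cM ?cz ?leq_add2r //.
  - by apply: dU; apply: Zdis; rewrite ?orbT.
  - by apply: Zdis; rewrite ?orbT.
  - by apply: dU; apply: Zdis; rewrite ?orbT.
  - by apply: Zdis; rewrite ?orbT.
  - rewrite -setI_eq0; apply/eqP/setP => x; rewrite in_setI in_set0.
    apply/negbTE/negP => /andP[/(subsetP (PP _)) h /(subsetP (PP _)) h'].
    by move: p12; rewrite (P_disj h h') eqxx.
  exists (S, E) => _; split=> //=.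
    by apply: subset_trans sS _; apply: sub.
  by apply: subset_trans sE _; apply: sub.
pose Zg (p : J * J) := Z p.1 0 :|: Z p.1 4 :|: Z p.1 1 :|:
        (Z p.2 0 :|: Z p.2 4 :|: Z p.2 1).
have ZgE p x : x \in Zg p -> exists j i, [/\ x \in Z j i, i \in [:: 0; 1; 4] &
    j \in [:: p.1; p.2]].
  rewrite /Zg !inE; move=> /orP[/orP[/orP[]|]|/orP[/orP[]|]] h;
   [exists p.1, 0|exists p.1, 4|exists p.1, 1|exists p.2, 0|exists p.2, 4|exists p.2, 1];
   by split; rewrite ?h ?inE ?eqxx ?orbT.
have i5 i : i \in [:: 0; 1; 4] -> i < 5.
  by rewrite !inE => /or3P[] /eqP->.
have Zgd p p' : p \in pps -> p' \in pps -> p != p' -> [disjoint Zg p & Zg p'].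
  move=> pin p'in ne; rewrite -setI_eq0; apply/eqP/setP => x.
  rewrite in_setI in_set0; apply/negbTE/negP => /andP[].
  move=> /ZgE[j [i [h /i5 lt jp]]] /ZgE[j' [i' [h' /i5 lt' jp']]].
  have [E _] := Zinj _ _ _ _ _ lt lt' h h'; rewrite -E in jp'.
  move: jp jp'; rewrite !inE => /orP[/eqP->|/eqP->] /orP[] /eqP E'.
  - by move: ne; rewrite (pps1 pin p'in E') eqxx.
  - by move: (pps12 pin p'in); rewrite E' eqxx.
  - by move: (pps12 p'in pin); rewrite E' eqxx.
  - by move: ne; rewrite (pps2 pin p'in E') eqxx.
have ZgL p : [disjoint Zg p & lks Lk].
  rewrite -setI_eq0; apply/eqP/setP => x.
  rewrite in_setI in_set0; apply/negbTE/negP => /andP[].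
  move=> /ZgE[j [i [h iin jp]]] /bigcupP[w _ h'].
  have [_ E] := Zinj _ _ _ _ _ (i5 _ iin) (b5 _) h h'.
  by move: iin; rewrite E; case: (w.2).
have [||||||s [zs us]] := @close_chain T e J R P m Lk RJ LkP Lkd
   (fun p => (SE p).1) (fun p => (SE p).2) Zg (fun p => l.*2 + (f p).*2) wsf K
   p0 ps wc (odd t).
- by [].
- by move=> p /SEP[? ? ? ?]; split.
- move=> p p' pin p'in ne; split; first exact: Zgd.
  by have [] := wsP (p, p') pin p'in.
- exact: pwc.
- exact: uwc.
- move=> w; rewrite cLk; apply: leq_trans z_link; rewrite leq_add2l leq_mul2r.
  by rewrite rE leqnSn orbT.
exists s; split=> //; rewrite zs chainE.
have -> : \sum_(p <- pps) (l.*2 + (f p).*2) = (r * l).*2 + (\sum_(p <- pps) f p).*2.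
  rewrite big_split /= big_const_seq count_predT iter_addn_0 -/r; congr (_ + _).
    by rewrite -!muln2 mulnAC [l * r]mulnC.
  by rewrite -!muln2 big_distrl /=; apply: eq_bigr => p _; rewrite muln2.
rewrite fs.
have even : odd (t - W) = false.
  rewrite oddB ?oW ?addbb //; apply: leq_trans W_le _; apply: leq_trans tE.
  by rewrite leq_mul2l; apply/orP; right; clear; lia.
have halfE : (t - W)./2 * 2 = t - W.
  by rewrite muln2 -[RHS]odd_double_half even.
move: halfE; rewrite -addnA -/W; move: (t - W)./2 => H halfE.
by clear -halfE tE W_le; nia.
Qed.

End Embedding.

(** * A partition into edgeless and joined pairs *)

Section Blocks.

Variable T : finType.
Implicit Types (F : {set {set T}}) (A B D X Y : {set T}).

(** In a maximal family of such blocks, no class of [key] has more than [M] uncovered vertices,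
    since another block would fit. *)
Lemma equal_blocks (K : finType) (key : T -> K) D M : 0 < M ->
  exists F, [/\ trivIset F,
    forall A, A \in F -> [/\ #|A| = M, A \subset D &
      {in A &, forall x y, key x = key y}] &
    #|D :\: cover F| <= #|key @: D| * M].
Proof.
move=> M0.
pose P F := trivIset F && [forall A in F, [&& #|A| == M, A \subset D &
  [forall x in A, forall y in A, key x == key y]]].
have P0 : P set0.
  rewrite /P; apply/andP; split; last by apply/forall_inP => A; rewrite inE.
  by apply/trivIsetP => A B; rewrite inE.
case: (arg_maxnP (fun F => #|F|) P0) => F /andP[tF /forall_inP FP] Fmax.
exists F; split=> // [A /FP/and3P[/eqP cA AD /forall_inP kA]|].
  by split=> // x y xA yA; have /forall_inP/(_ y yA)/eqP := kA x xA.
pose L k := [set x in D :\: cover F | key x == k].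
have Lk k : #|L k| <= M.
  rewrite leqNgt; apply/negP => /ltnW/subset_of_card[S SL cS].
  have S0 : S != set0 by rewrite -card_gt0 cS.
  have Sd : {in F, forall B, [disjoint S & B]}.
    move=> B BF; rewrite disjoints_subset; apply: subset_trans SL _.
    apply/subsetP => x; rewrite !inE => /andP[/andP[xF _] _].
    by apply: contra xF => xB; apply/bigcupP; exists B.
  have F0 : set0 \notin F.
    by apply/negP => /FP/and3P[/eqP]; rewrite cards0; case: (M) M0.
  have [tS SF] := trivIsetU1 Sd tF F0.
  have := Fmax (S |: F); rewrite cardsU1 SF /= => H.
  suff /H : P (S |: F) by rewrite add1n ltnn.
  rewrite /P tS; apply/forall_inP => A; rewrite !inE => /orP[/eqP->|/FP//].
  rewrite cS eqxx /=; apply/andP; split.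
    by apply: subset_trans SL _; apply/subsetP => x; rewrite !inE => /andP[/andP[]].
  apply/forall_inP => x /(subsetP SL); rewrite !inE => /andP[_ /eqP->].
  by apply/forall_inP => y /(subsetP SL); rewrite !inE => /andP[_ /eqP->].
rewrite -sum1_card (partition_big key (mem (key @: D))) /=; last first.
  by move=> x; rewrite inE => /andP[_ xD]; apply: imset_f.
rewrite -sum_nat_const; apply: leq_sum => k _.
apply: leq_trans (Lk k); rewrite sum1dep_card; apply: eq_leq.
by apply: eq_card => x; rewrite !inE.
Qed.

Variable e : rel T.

Definition edgeless A B := [forall x in A, forall y in B, ~~ e x y].

Lemma edgelessP A B :
  reflect (forall x y, x \in A -> y \in B -> ~~ e x y) (edgeless A B).
Proof.
apply: (iffP forall_inP) => [H x y xA yB|H x xA].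
  by have /forall_inP/(_ y yB) := H x xA.
by apply/forall_inP => y yB; apply: H.
Qed.

Lemma edgelessS A B A' B' : A' \subset A -> B' \subset B ->
  edgeless A B -> edgeless A' B'.
Proof.
move=> /subsetP sA /subsetP sB /edgelessP H; apply/edgelessP => x y xA yB.
by apply: H; [apply: sA | apply: sB].
Qed.

Definition bad_pairs m F : {set {set T} * {set T}} :=
  [set p in setX F F | ~~ edgeless p.1 p.2 && ~~ joined e m p.1 p.2].

Definition edgeless_pts F : {set T * T} :=
  [set p | [exists A in F, exists B in F,
     [&& p.1 \in A, p.2 \in B & edgeless A B]]].

Lemma edgeless_ptsP F x y :
  reflect (exists A B, [/\ A \in F, B \in F, x \in A, y \in B & edgeless A B])
          ((x, y) \in edgeless_pts F).
Proof.
rewrite inE; apply: (iffP exists_inP) => [[A AF /exists_inP[B BF /and3P[]]]|].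
  by exists A, B.
by move=> [A [B [AF BF xA yB h]]]; exists A => //; apply/exists_inP; exists B; rewrite ?xA ?yB.
Qed.

(** The witnesses of the bad pairs span pairwise disjoint rectangles of at least [m ^ 2] point pairs
    each. None of these was counted before, because a bad pair is not edgeless. Only pairs with a
    point lost in the new cutting are forfeited. *)
Lemma refine_blocks m F M : 0 < M -> trivIset F ->
  exists F', [/\ trivIset F', forall A, A \in F' -> #|A| = M,
    #|cover F :\: cover F'| <= #|F| * 2 ^ (2 * #|F| ^ 2) * M &
    #|edgeless_pts F| + #|bad_pairs m F| * m ^ 2 <=
    #|edgeless_pts F'| + 2 * (#|T| * #|cover F :\: cover F'|)].
Proof.
move=> M0 tF.
have /fin_all_exists[XY XYP] (p : {set T} * {set T}) :
    exists XY : {set T} * {set T}, p \in bad_pairs m F ->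
    [/\ XY.1 \subset p.1, XY.2 \subset p.2, m <= #|XY.1|, m <= #|XY.2| &
        edgeless XY.1 XY.2].
  case: (boolP (p \in _)) => pb; last by exists (set0, set0).
  move: pb; rewrite inE => /and3P[_ _ /forallPn[X /forallPn[Y]]].
  rewrite negb_imply => /andP[/and4P[XA YB mX mY] no].
  exists (X, Y) => _; split=> //=; apply/edgelessP => x y xX yY.
  apply: contra no => exy; apply/exists_inP; exists x => //.
  by apply/exists_inP; exists y.
pose bad := bad_pairs m F.
pose Wt := [set (XY p).1 | p in bad] :|: [set (XY p).2 | p in bad].
have cWt : #|Wt| <= 2 * #|F| ^ 2.
  apply: leq_trans (leq_cardsU _ _) _; rewrite mul2n -addnn.
  have cb : #|bad| <= #|F| ^ 2.
    by rewrite -mulnn -cardsX; apply/subset_leq_card/subsetP => p; rewrite inE => /andP[].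
  by apply: leq_add; apply: leq_trans (leq_imset_card _ _) cb.
(* Blocks that are constant for this key lie inside one old block and inside or outside each
   witness. *)
pose key x := (pblock F x, [set W in Wt | x \in W]).
have [F' [tF' F'P lF']] := equal_blocks key (cover F) M0.
have F'F B x A : B \in F' -> x \in B -> A \in F -> x \in A -> B \subset A.
  move=> BF xB AF xA; apply/subsetP => y yB.
  have [_ BD kB] := F'P B BF; have [E _] := kB x y xB yB.
  by rewrite -(def_pblock tF AF xA) E mem_pblock; apply: (subsetP BD).
have F'W B x W : B \in F' -> x \in B -> W \in Wt -> x \in W -> B \subset W.
  move=> BF xB WW xW; apply/subsetP => y yB.
  have [_ BD kB] := F'P B BF; have [_ /setP/(_ W)] := kB x y xB yB.
  by rewrite !inE -in_setU WW xW /=.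
have F'bl x : x \in cover F' -> exists2 B, B \in F' & x \in B.
  by move=> /bigcupP[B BF xB]; exists B.
exists F'; split=> // [A /F'P[]//||].
  apply: leq_trans lF' _; rewrite leq_mul2r; apply/orP; right.
  apply: (@leq_trans #|setX F (powerset Wt)|).
    apply/subset_leq_card/subsetP => _ /imsetP[x xD ->].
    rewrite inE /= powersetE pblock_mem //=; apply/subsetP => W.
    by rewrite inE => /andP[].
  by rewrite cardsX card_powerset leq_mul2l leq_exp2l // cWt orbT.
pose G p := if p \in bad then setX (XY p).1 (XY p).2 else set0.
have GP p x y : (x, y) \in G p -> [/\ p \in bad, x \in (XY p).1, y \in (XY p).2,
   x \in p.1 & y \in p.2].
  rewrite /G; case: ifP => [pb|_]; last by rewrite inE.
  have [s1 s2 _ _ _] := XYP p pb; rewrite in_setX /= => /andP[h1 h2].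
  by split=> //; [apply: (subsetP s1) | apply: (subsetP s2)].
have badF p : p \in bad -> [/\ p.1 \in F, p.2 \in F & ~~ edgeless p.1 p.2].
  by rewrite inE => /and3P[]; rewrite inE => /andP[-> ->] -> _.
have Fun A B x : A \in F -> B \in F -> x \in A -> x \in B -> A = B.
  by move=> AF BF xA xB; rewrite -(def_pblock tF AF xA) (def_pblock tF BF xB).
have Gd p p' : p != p' -> [disjoint G p & G p'].
  move=> ne; rewrite -setI_eq0; apply/eqP/setP => -[x y]; rewrite in_setI in_set0.
  apply/negbTE/negP => /andP[/GP[/badF[h1 h2 _] _ _ x1 y1] /GP[/badF[h1' h2' _] _ _ x1' y1']].
  move: ne; rewrite (surjective_pairing p) (surjective_pairing p').
  by rewrite (Fun _ _ _ h1 h1' x1 x1') (Fun _ _ _ h2 h2' y1 y1') eqxx.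
pose GG := \bigcup_p G p.
have cGG : #|bad| * m ^ 2 <= #|GG|.
  rewrite -[#|GG|]sum1_card (partition_disjoint_bigcup _ _ Gd) -sum_nat_const.
  rewrite [X in _ <= X](bigID (mem bad)) /=; apply: leq_trans (leq_addr _ _).
  apply: leq_sum => p pb; rewrite sum1_card /G pb cardsX -mulnn.
  by have [_ _ m1 m2 _] := XYP p pb; apply: leq_mul.
have dG : [disjoint edgeless_pts F & GG].
  rewrite -setI_eq0; apply/eqP/setP => -[x y]; rewrite in_setI in_set0.
  apply/negbTE/negP => /andP[/edgeless_ptsP[A [B [AF BF xA yB el]]] /bigcupP[p _]].
  move=> /GP[/badF[h1 h2 nel] _ _ x1 y1]; move: nel.
  by rewrite -(Fun _ _ _ AF h1 xA x1) -(Fun _ _ _ BF h2 yB y1) el.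
pose Lo := cover F :\: cover F'.
apply: (@leq_trans #|edgeless_pts F :|: GG|).
  by rewrite cardsU (disjoint_setI0 dG) cards0 subn0 leq_add2l.
apply: (@leq_trans #|edgeless_pts F' :|: (setX Lo [set: T] :|: setX [set: T] Lo)|).
  apply/subset_leq_card/subsetP => -[x y] xyG.
  rewrite in_setU in_setU !in_setX !in_setT andbT /= !(in_setD, in_setT).
  have [xF yF] : x \in cover F /\ y \in cover F.
    move: xyG; rewrite in_setU => /orP[/edgeless_ptsP[A [B [AF BF xA yB _]]]|].
      by split; apply/bigcupP; [exists A|exists B].
    move=> /bigcupP[p _ /GP[/badF[h1 h2 _] _ _ x1 y1]].
    by split; apply/bigcupP; [exists p.1|exists p.2].
  rewrite xF yF !andbT.
  case: (boolP (x \in cover F')) => xF'; last by rewrite orbT.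
  case: (boolP (y \in cover F')) => yF'; last by rewrite !orbT.
  rewrite !orbF; have [B BF xB] := F'bl x xF'; have [B' BF' yB] := F'bl y yF'.
  apply/edgeless_ptsP; exists B, B'; split=> //.
  move: xyG; rewrite in_setU => /orP[/edgeless_ptsP[A [A' [AF AF' xA yA el]]]|].
    by apply: edgelessS el; [apply: F'F AF xA|apply: F'F AF' yA].
  move=> /bigcupP[p _ /GP[pb x1 y1 _ _]]; have [_ _ _ _ el] := XYP p pb.
  apply: edgelessS el.
    by apply: F'W x1 => //; rewrite in_setU (imset_f (fun p => (XY p).1) pb).
  by apply: F'W y1 => //; rewrite in_setU (imset_f (fun p => (XY p).2) pb) orbT.
apply: leq_trans (leq_cardsU _ _) _; rewrite leq_add2l.
apply: leq_trans (leq_cardsU _ _) _; rewrite !cardsX cardsT mul2n -addnn.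
by rewrite [_ * #|T|]mulnC.
Qed.

End Blocks.

Section JoinedPartition.

Variables (a b w : nat).
Hypotheses (a_gt1 : 1 < a) (b_gt0 : 0 < b) (w_gt0 : 0 < w).

(** Blocks exceed the scale [m] by the factor [w], so that they can be cut into several pieces to
    which joinedness still applies. *)
Definition good_blocks (T : finType) (e : rel T) N m (F : {set {set T}}) :=
  [/\ [&& 0 < m, m <= #|T| & #|T| <= N * m], trivIset F, {in F, forall A : {set T}, #|A| = w * m},
      a * #|~: cover F| <= #|T| & b * #|bad_pairs e m F| <= #|F| ^ 2].

Let C := 8 * b * w ^ 2.
(** A refinement may lose a [1 / loss] share of the vertices: over all rounds this stays within the
    uncovered share [1 / a], and in each round it costs at most half of the gain. *)
Let loss := 2 * a * C.+2.

Let divn_bounds n D : 0 < D -> D <= n ->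
  [/\ 0 < n %/ D, D * (n %/ D) <= n & n <= 2 * D * (n %/ D)].
Proof.
move=> D0 Dn; have q0 : 0 < n %/ D by rewrite divn_gt0.
split=> //; first by rewrite mulnC leq_trunc_div.
have := ltn_ceil n D0; nia.
Qed.

(* Each round in which too many pairs are bad adds [n ^ 2 / C] to the number of
   pairs of points lying in edgeless pairs of blocks, so [C + 1] rounds are
   impossible. *)
Lemma good_blocks_step s j N0 : s + j = C.+1 ->
  exists N n0, forall (T : finType) (e : rel T) m (F : {set {set T}}),
  n0 <= #|T| -> 0 < m <= #|T| -> #|T| <= N0 * m -> trivIset F ->
  {in F, forall A : {set T}, #|A| = w * m} ->
  j * #|T| ^ 2 <= C * #|edgeless_pts e F| ->
  a * C.+2 * #|~: cover F| <= j.+1 * #|T| ->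
  exists m' F', good_blocks e N m' F'.
Proof.
elim: s j N0 => [|s IH] j N0 sj.
  exists 0, 1 => T e m F n0 /andP[m0 _] _ _ _ H _; exfalso.
  have : #|edgeless_pts e F| <= #|T| ^ 2.
    by apply: leq_trans (max_card _) _; rewrite card_prod mulnn.
  have : 0 < #|T| ^ 2 by rewrite expn_gt0 n0.
  move: H; rewrite add0n in sj; rewrite sj.
  move: #|_| (_ ^ 2) C => x y c; nia.
pose E := 2 ^ (2 * N0 ^ 2).
(* The scale must drop to about [#|T| / D]: up to [N0 * E] key classes each leave [w * m'] vertices
   uncovered. *)
pose D := (N0 * E * w * loss).+1.
have [N [n1 H]] := IH j.+1 (2 * D) ltac:(by rewrite addnS -addSn).
exists (maxn N N0), (maxn n1 D) => T e m F; rewrite geq_max => /andP[n1T DT].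
move=> /andP[m0 mT] TN0 tF cF Hemp Hcov.
have jC : j.+1 <= C.+1 by rewrite -sj addSn ltnS leq_addl.
have covF : a * #|~: cover F| <= #|T|.
  rewrite -(leq_pmul2l (ltn0Sn C.+1)) mulnA [_ * a]mulnC.
  by apply: leq_trans Hcov _; rewrite leq_mul2r; apply/orP; right; apply: leqW.
case: (leqP (b * #|bad_pairs e m F|) (#|F| ^ 2)) => bad.
  exists m, F; split=> //; rewrite m0 mT /=; apply: leq_trans TN0 _.
  by rewrite leq_mul2r leq_maxr orbT.
have cardF : #|cover F| = #|F| * (w * m).
  rewrite -(eqP tF) (eq_bigr (fun _ => w * m)) ?sum_nat_const //.
have FN0 : #|F| <= N0.
  rewrite -(leq_pmul2r m0); apply: leq_trans TN0.
  apply: leq_trans (max_card (mem (cover F))); rewrite cardF leq_mul2l.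
  by rewrite leq_pmull ?orbT.
have [m'0 Dm' m'D] := divn_bounds (ltn0Sn _) DT.
set m' := _ %/ _ in m'0 Dm' m'D.
have [F' [tF' cF' lF' gain]] := refine_blocks e m (M := w * m') (F := F) ltac:(by rewrite muln_gt0 w_gt0) tF.
have EF : 2 ^ (2 * #|F| ^ 2) <= E.
  by rewrite leq_exp2l // leq_mul2l leq_exp2r.
have lossF : loss * #|cover F :\: cover F'| <= #|T|.
  apply: leq_trans Dm'.
  apply: (@leq_trans (loss * (N0 * E * (w * m')))).
    rewrite leq_mul2l; apply/orP; right; apply: leq_trans lF' _.
    by rewrite leq_mul2r leq_mul ?orbT.
  by rewrite /D mulSn; nia.
have covF' : #|~: cover F'| <= #|~: cover F| + #|cover F :\: cover F'|.
  apply: leq_trans (leq_cardsU _ _); apply/subset_leq_card/subsetP => x.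
  by rewrite !inE; case: (x \in cover F) => //= ->.
have covT : #|T| <= 2 * #|cover F|.
  have h : 2 * #|~: cover F| <= #|T| by apply: leq_trans covF; rewrite leq_mul2r a_gt1 orbT.
  by have := cardsC (cover F); move: h; clear; lia.
have [|||m1 [F1 G1]] := H T e m' F' n1T _ m'D tF' cF'.
- by rewrite m'0 /=; apply: leq_trans Dm'; rewrite leq_pmull.
(* The blocks cover at least half of the vertices, so the witnesses gain at least [2 * #|T| ^ 2 / C]
   pairs; the lost vertices cost at most half of that. *)
- have h1 : C * (#|bad_pairs e m F| * m ^ 2) >= 2 * #|T| ^ 2.
    apply: (@leq_trans (8 * #|cover F| ^ 2)).
      by rewrite -[8]/(2 * 2 ^ 2) -mulnA leq_mul2l /= -expnMn leq_exp2r.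
    rewrite cardF !expnMn /C.
    move: bad; move: (#|F| ^ 2) #|bad_pairs _ _ _| (w ^ 2) (m ^ 2) => x y u v.
    move=> /ltnW xy; have := leq_mul xy (leqnn (u * v)).
    clear; nia.
  have h2 : 2 * C * (2 * (#|T| * #|cover F :\: cover F'|)) <= 2 * #|T| ^ 2.
    have : 2 * C * #|cover F :\: cover F'| <= #|T|.
      apply: leq_trans lossF; rewrite leq_mul2r /loss; apply/orP; right.
      by rewrite -mulnA leq_mul2l /=; move: a_gt1; clear; nia.
    move=> h; have := leq_mul h (leqnn #|T|); rewrite mulnn; clear; nia.
  have := leq_mul (leqnn C) gain; rewrite !mulnDr mulSn.
  by move: Hemp h1 h2; clear; lia.
- have h : a * C.+2 * #|~: cover F'| <=
      a * C.+2 * #|~: cover F| + a * C.+2 * #|cover F :\: cover F'|.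
    by rewrite -mulnDr leq_mul2l covF' orbT.
  have h2 : a * C.+2 * #|cover F :\: cover F'| <= #|T|.
    apply: leq_trans lossF; rewrite leq_mul2r /loss; apply/orP; right.
    by rewrite -mulnA leq_pmull.
  by apply: leq_trans h _; rewrite mulSn addnC leq_add.
exists m1, F1; case: G1 => /and3P[g1 g2 g3] *; split=> //.
rewrite g1 g2; apply: leq_trans g3 _.
by rewrite leq_mul2r leq_maxl orbT.
Qed.

Lemma joined_partition : exists N n0, forall (T : finType) (e : rel T),
  n0 <= #|T| -> exists m F, good_blocks e N m F.
Proof.
pose D := w * a * C.+2.
have D0 : 0 < D by rewrite /D !muln_gt0 w_gt0 (ltnW a_gt1).
have [N [n0 H]] := @good_blocks_step C.+1 0 (2 * D) (addn0 _).
exists N, (maxn n0 D) => T e; rewrite geq_max => /andP[n0T DT].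
have [m0 Dm mD] := divn_bounds D0 DT; set m := _ %/ _ in m0 Dm mD.
have [F [tF FP lF]] := @equal_blocks T unit (fun _ => tt) setT (w * m)
  ltac:(by rewrite muln_gt0 w_gt0).
apply: (H T e m F) => //.
- by rewrite m0 /=; apply: leq_trans Dm; rewrite leq_pmull.
- by move=> A /FP[].
- rewrite mul1n; apply: leq_trans Dm; rewrite setTD in lF.
  have : #|(fun _ : T => tt) @: [set: T]| <= 1.
    by rewrite -[1]card_unit max_card.
  move=> h; have {lF h} := leq_trans lF (leq_mul h (leqnn _)).
  by rewrite /D mul1n; move: #|_| => x; nia.
Qed.

End JoinedPartition.

(** * Matchings and components of the reduced graph *)

Section HallDefect.

Variables (J : finType) (R : rel J).
Implicit Types (H S : {set J}) (E : {set J * J}).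

Let nbE E S := [set y | [exists x in S, (x, y) \in E]].

Let nbEP E S y : reflect (exists2 x, x \in S & (x, y) \in E) (y \in nbE E S).
Proof. by rewrite inE; apply: exists_inP. Qed.

Let hall_cond H r E := [forall S : {set J},
  (S \subset H) ==> (#|S| + r <= #|nbE E S| + #|H|)].

Let hall_condP H r E : reflect (forall S, S \subset H ->
  #|S| + r <= #|nbE E S| + #|H|) (hall_cond H r E).
Proof.
apply: (iffP forallP) => h S; first exact/implyP.
by apply/implyP; apply: h.
Qed.

(* In an edge-minimal subgraph satisfying the condition, submodularity of the
   neighbourhood forces every left vertex to have degree at most one. *)
Let minimal_degree H r E x y1 y2 : hall_cond H r E ->
  (forall p, p \in E -> ~~ hall_cond H r (E :\ p)) ->
  (x, y1) \in E -> (x, y2) \in E -> y1 = y2.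
Proof.
move=> /hall_condP hE minE xy1 xy2; apply/eqP/negPn/negP => ne.
have viol y : (x, y) \in E -> exists S, [/\ S \subset H, x \in S &
    #|nbE (E :\ (x, y)) S| + #|H| < #|S| + r].
  move=> /minE/forallPn[S]; rewrite negb_imply -ltnNge => /andP[SH lt].
  exists S; split=> //; apply/negPn/negP => xS.
  have := hE S SH; suff -> : nbE E S = nbE (E :\ (x, y)) S by rewrite leqNgt lt.
  apply/setP => z; apply/nbEP/nbEP => -[x' x'S x'z]; exists x' => //.
    by rewrite !inE x'z andbT; apply: contraNneq xS => -[<- _].
  by move: x'z; rewrite inE => /andP[].
have [S1 [S1H xS1 v1]] := viol y1 xy1; have [S2 [S2H xS2 v2]] := viol y2 xy2.
set N1 := nbE _ _ in v1; set N2 := nbE _ _ in v2.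
have hU : #|nbE E (S1 :|: S2)| <= #|N1 :|: N2|.
  apply/subset_leq_card/subsetP => z /nbEP[x' x'S x'z].
  have [/eqP[Ex Ez]|ne1] := boolP ((x', z) == (x, y1)).
    rewrite in_setU; apply/orP; right; apply/nbEP; exists x => //.
    by rewrite !inE Ez xy1 andbT xpair_eqE eqxx.
  have [/eqP[Ex Ez]|ne2] := boolP ((x', z) == (x, y2)).
    rewrite in_setU; apply/orP; left; apply/nbEP; exists x => //.
    by rewrite !inE Ez xy2 andbT xpair_eqE eqxx eq_sym.
  rewrite in_setU; move: x'S; rewrite in_setU => /orP[x'S|x'S]; apply/orP.
    by left; apply/nbEP; exists x' => //; rewrite in_setD1 ne1.
  by right; apply/nbEP; exists x' => //; rewrite in_setD1 ne2.
have hI : #|nbE E ((S1 :&: S2) :\ x)| <= #|N1 :&: N2|.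
  apply/subset_leq_card/subsetP => z /nbEP[x']; rewrite !in_setD1 in_setI.
  move=> /and3P[x'x x'1 x'2] x'z; rewrite in_setI.
  by apply/andP; split; apply/nbEP; exists x' => //;
     rewrite in_setD1 x'z xpair_eqE (negbTE x'x).
have := hE (S1 :|: S2); rewrite subUset S1H S2H => /(_ isT).
have := hE ((S1 :&: S2) :\ x) ltac:(by rewrite subDset subsetU // (subset_trans (subsetIl _ _) S1H) orbT).
have := cardsUI S1 S2; have := cardsUI N1 N2.
have := cardsD1 x (S1 :&: S2); rewrite in_setI xS1 xS2 /=.
by move: v1 v2 hU hI; clear; lia.
Qed.

(** In a minimal edge set each left vertex has at most one edge. Choosing one edge for every right
    vertex that is reached therefore gives distinct left ends, and the condition for [S = H] says
    that at least [r] right vertices are reached. *)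
Lemma hall_defect H r :
  (forall S, S \subset H -> #|S| + r <= #|nbhd R S| + #|H|) ->
  exists ps : seq (J * J), [/\ r <= size ps, uniq ps,
    {in ps, forall p, p.1 \in H /\ R p.1 p.2},
    {in ps &, forall p p', p.1 = p'.1 -> p = p'} &
    {in ps &, forall p p', p.2 = p'.2 -> p = p'}].
Proof.
move=> cond; pose E0 := [set p : J * J | (p.1 \in H) && R p.1 p.2].
have P0 : (E0 \subset E0) && hall_cond H r E0.
  rewrite subxx; apply/hall_condP => S SH; apply: leq_trans (cond S SH) _.
  rewrite leq_add2r; apply/subset_leq_card/subsetP => y /nbhdP[x xS xy].
  by apply/nbEP; exists x; rewrite // inE /= (subsetP SH).
case: (arg_minnP (P := fun E => (E \subset E0) && hall_cond H r E)
        (fun E => #|E|) P0) => E /andP[EE0 hE] Emin.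
have Edeg x y1 y2 : (x, y1) \in E -> (x, y2) \in E -> y1 = y2.
  apply: (minimal_degree hE) => p pE; apply/negP => hEp.
  have sub : E :\ p \subset E0 by apply: subset_trans EE0; rewrite subsetDl.
  by have := Emin (E :\ p); rewrite sub hEp (cardsD1 p E) pE ltnn => /(_ isT).
have /fin_all_exists[g gP] y : exists x, y \in nbE E H -> (x, y) \in E.
  case: (boolP (y \in nbE E H)) => [/nbEP[x _ xy]|_]; first by exists x.
  by exists y.
have inE0 x y : (x, y) \in E -> x \in H /\ R x y.
  by move=> /(subsetP EE0); rewrite inE => /andP[].
exists [seq (g y, y) | y <- enum (nbE E H)].
have psP p : p \in [seq (g y, y) | y <- enum (nbE E H)] -> p \in E.
  by move=> /mapP[y]; rewrite mem_enum => /gP yE ->.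
split.
- rewrite size_map -cardE; have := (elimT (hall_condP _ _ _) hE) H (subxx _).
  by rewrite addnC leq_add2r.
- by rewrite map_inj_uniq ?enum_uniq // => y y' [].
- by move=> [x y] /psP/inE0.
- move=> [x y] [x' y'] /psP h /psP h' /= E1; rewrite E1 in h *.
  by rewrite (Edeg _ _ _ h h').
- move=> p p' /mapP[y _ ->] /mapP[y' _ ->] /= -> //.
Qed.

End HallDefect.

Section Components.

Variables (J : finType) (R : rel J).
Hypothesis R_sym : symmetric R.
Implicit Types (H S X Y : {set J}).

Definition deg x := #|[set y | R x y]|.

Lemma sum_deg H : \sum_(x in H) deg x = #|[set p : J * J | (p.1 \in H) && R p.1 p.2]|.
Proof.
rewrite -[RHS]sum1_card (eq_bigl (fun p => (p.1 \in H) && R p.1 p.2)); last first.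
  by move=> p; rewrite inE.
rewrite -(pair_big_dep (fun x => x \in H) (fun x y => R x y) (fun _ _ => 1)) /=.
by apply: eq_bigr => x _; rewrite sum1dep_card.
Qed.

Definition closed_set H := forall x y, x \in H -> R x y -> y \in H.

Lemma sum_deg_max H : closed_set H -> \sum_(x in H) deg x <= #|H| ^ 2.
Proof.
move=> cH; rewrite -mulnn -sum_nat_const; apply: leq_sum => x xH.
by apply/subset_leq_card/subsetP => y; rewrite inE; apply: cH.
Qed.

(** No edge joins [S] to the part of [H] outside its neighbourhood. Both orders of such a pair are
    missing, and the square corrects for pairs counted twice. *)
Lemma sum_deg_cover H S : closed_set H -> S \subset H ->
  \sum_(x in H) deg x + 2 * (#|S| * #|H :\: nbhd R S|) <=
  #|H| ^ 2 + #|S :&: (H :\: nbhd R S)| ^ 2.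
Proof.
move=> cH SH; set Q := H :\: nbhd R S; rewrite sum_deg; set E := [set p | _].
have QH : Q \subset H by apply: subsetDl.
have noSQ x y : x \in S -> y \in Q -> ~~ R x y.
  move=> xS; rewrite inE => /andP[yN _]; apply: contra yN => xy.
  by apply/nbhdP; exists x.
have dE : [disjoint E & setX S Q :|: setX Q S].
  rewrite -setI_eq0; apply/eqP/setP => -[x y]; rewrite in_setI in_setU !in_setX in_set0.
  rewrite inE /=; apply/negbTE/negP => /andP[/andP[_ xy] /orP[] /andP[h h']].
    by have := noSQ x y h h'; rewrite xy.
  by have := noSQ y x h' h; rewrite R_sym xy.
have sub : E :|: (setX S Q :|: setX Q S) \subset setX H H.
  rewrite !subUset !setXS // !andbT; apply/subsetP => -[x y].
  by rewrite inE in_setX /= => /andP[xH xy]; rewrite xH (cH x y).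
have cI : #|setX S Q :&: setX Q S| = #|S :&: Q| ^ 2.
  rewrite -mulnn -cardsX; apply: eq_card => -[x y].
  by rewrite !(in_setI, in_setX) /= andbACA [(y \in Q) && _]andbC.
have := subset_leq_card sub; rewrite cardsX mulnn cardsU (disjoint_setI0 dE) cards0 subn0.
by have := cardsUI (setX S Q) (setX Q S); rewrite cI !cardsX; nia.
Qed.

Lemma connect_closed x0 : closed_set [set y | connect R x0 y].
Proof.
by move=> x y; rewrite !inE => x0x xy; apply: connect_trans x0x (connect1 xy).
Qed.

Lemma dbl_sym : connect_sym (dbl R).
Proof.
by apply: sym_connect_sym => u v; rewrite /dbl R_sym eq_sym.
Qed.

Lemma dbl_flip u v : connect (dbl R) u v ->
  connect (dbl R) (u.1, ~~ u.2) (v.1, ~~ v.2).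
Proof.
move=> /connectP[p ep ->]; elim: p u ep => [|w p IH] u /=; first by rewrite connect0.
move=> /andP[/andP[uw ne] ep]; apply: connect_trans (IH w ep).
by apply: connect1; rewrite /dbl /= uw; move: ne; case: u.2; case: w.2.
Qed.

Lemma connect_dbl x0 x : connect R x0 x ->
  exists b, connect (dbl R) (x0, false) (x, b).
Proof.
move=> /connectP[p ep ->]; elim/last_ind: p ep => [|p y IH].
  by exists false; rewrite connect0.
rewrite rcons_path last_rcons => /andP[/IH[b h] xy].
exists (~~ b); apply: connect_trans h (connect1 _).
by rewrite /dbl /= xy; case: b.
Qed.

(** Without an odd closed walk at [x0] the two levels reachable from it project to disjoint sides of
    a bipartition of the component. *)
Lemma sum_deg_bipartite x0 : ~~ connect (dbl R) (x0, false) (x0, true) ->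
  2 * \sum_(x in [set y | connect R x0 y]) deg x <= #|[set y | connect R x0 y]| ^ 2.
Proof.
move=> nb; set H := [set y | _].
pose Y b := [set x | connect (dbl R) (x0, false) (x, b)].
have dY : [disjoint Y false & Y true].
  rewrite -setI_eq0; apply/eqP/setP => x; rewrite !inE.
  apply/negbTE/negP => /andP[h h']; move/negP: nb; apply.
  have /= h2 := dbl_flip h; apply: connect_trans h' _; rewrite dbl_sym.
  exact: h2.
have HY : H = Y false :|: Y true.
  apply/setP => x; rewrite !inE; apply/idP/orP.
    by move=> /connect_dbl[[] h]; [right|left].
  have proj u v : connect (dbl R) u v -> connect R u.1 v.1.
    move=> /connectP[p ep ->]; elim: p u ep => [|w p IH] u /=; first by rewrite connect0.
    by move=> /andP[/andP[uw _] /IH]; apply: connect_trans (connect1 uw).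
  by case=> /proj.
have dd b : \sum_(x in Y b) deg x <= #|Y b| * #|Y (~~ b)|.
  rewrite -sum_nat_const; apply: leq_sum => x xY; apply/subset_leq_card/subsetP => y.
  rewrite !inE => xy; move: xY; rewrite inE => h; apply: connect_trans h (connect1 _).
  by rewrite /dbl /= xy; case: b.
have := dd false; have := dd true; rewrite /= => d1 d0.
rewrite HY cardsU (disjoint_setI0 dY) cards0 subn0.
rewrite (eq_bigl [predU Y false & Y true]); last by move=> x; rewrite !inE.
rewrite bigU //=; move: d1 d0.
move: (\sum_(x in Y true) _) (\sum_(x in Y false) _) #|Y true| #|Y false|.
by move=> a b c d; have := (nat_AGM2 d c).1; clear; lia.
Qed.

Lemma sum_deg_components :
  \sum_x deg x = \sum_k \sum_(x in [set y | fingraph.root R y == k]) deg x.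
Proof.
rewrite (partition_big (fingraph.root R) xpredT) //=; apply: eq_bigr => k _.
by apply: eq_bigl => x; rewrite inE.
Qed.

Lemma sum_card_components : \sum_k #|[set y | fingraph.root R y == k]| = #|J|.
Proof.
rewrite -[RHS]sum1_card [RHS](partition_big (fingraph.root R) xpredT) //=; apply: eq_bigr => k _.
by rewrite sum1dep_card.
Qed.

Lemma component_connect k : [set y | fingraph.root R y == k] = set0 \/
  [set y | fingraph.root R y == k] = [set y | connect R k y].
Proof.
have cs : connect_sym R by apply: sym_connect_sym.
have [E|/set0Pn[x xk]] := eqVneq [set y | fingraph.root R y == k] set0; [by left|right].
have rk : fingraph.root R k == k by move: xk; rewrite inE => /eqP <-; rewrite root_root.
apply/setP => y; rewrite !inE -(root_connect cs) (eqP rk).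
exact: eq_sym.
Qed.

End Components.

Import Order.TTheory GRing.Theory Num.Theory.

(** * Extremal edge counts for components without a large matching *)

Section Extremal.

Variables (K : realType) (J : finType) (R : rel J).
Hypothesis R_sym : symmetric R.
Implicit Types (H S : {set J}) (rho sigma : K).

Local Open Scope ring_scope.

(** This is a partial injection along edges: a vertex may occur once as a first and once as a second
    coordinate, and loops are allowed. *)
Definition big_matching H rho := exists ps : seq (J * J),
  [/\ rho <= (size ps)%:R, uniq ps,
    {in ps, forall p, p.1 \in H /\ R p.1 p.2},
    {in ps &, forall p p', p.1 = p'.1 -> p = p'} &
    {in ps &, forall p p', p.2 = p'.2 -> p = p'}].

(** The two bounds are the extremal cases: a clique on [rho] vertices, and all pairs meeting a set
    of [rho / 2] vertices. For [p] below [h - rho / 2], replacing [i] by [p] and [q] by its lower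
    bound gives a convex function of [p], whose values at the ends [h - rho] and [h - rho / 2] are
    these bounds. *)
Lemma cover_bound (h p q i rho : K) : 0 <= i -> i <= p -> i <= q ->
  p <= h -> q <= h -> 2 * h - rho < p + q -> rho <= h ->
  h ^+ 2 - 2 * (p * q) + i ^+ 2 <= rho ^+ 2 \/
  h ^+ 2 - 2 * (p * q) + i ^+ 2 <= rho * h - rho ^+ 2 / 4.
Proof.
wlog pq : p q / p <= q.
  move=> W i0 ip iq ph qh spq rh; case: (leP p q) => [pq|/ltW qp]; first exact: W.
  rewrite [p * q]mulrC; apply: W => //; by rewrite [q + p]addrC.
move=> i0 ip iq ph qh spq rh.
have [big|small] := lerP (h - rho / 2) p.
  by right; nra.
case: (lerP (h ^+ 2 - 2 * (p * q) + i ^+ 2) (rho ^+ 2)) => [|h1]; [by left|right].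
rewrite leNgt; apply/negP => h2.
have pu : 0 < p - (h - rho) by lra.
have vp : 0 < h - rho / 2 - p by lra.
have ii : i ^+ 2 <= p ^+ 2 by rewrite ler_pXn2r // nnegrE; lra.
have pq' : 2 * (p * (2 * h - rho - p)) <= 2 * (p * q).
  by rewrite ler_pM2l // ler_wpM2l; lra.
have a1 : 2 * (p * (2 * h - rho - p)) - p ^+ 2 < h ^+ 2 - rho ^+ 2 by lra.
have a2 : 2 * (p * (2 * h - rho - p)) - p ^+ 2 < h ^+ 2 - rho * h + rho ^+ 2 / 4 by lra.
have b1 := mulr_gt0 vp (etrans (subr_gt0 _ _) a1).
have b2 := mulr_gt0 pu (etrans (subr_gt0 _ _) a2).
have b3 : 0 <= (p - (h - rho)) * (h - rho / 2 - p) * rho.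
  by apply: mulr_ge0; [apply: mulr_ge0; apply: ltW | lra].
nra.
Qed.

Lemma ceil_nat rho : 0 <= rho -> exists r : nat, rho <= r%:R < rho + 1.
Proof.
move=> r0; have /andP[h1 h2] := truncn_itv r0.
have [E|ne] := eqVneq (Num.truncn rho)%:R rho.
  by exists (Num.truncn rho); rewrite E lexx ltrDl ltr01.
exists (Num.truncn rho).+1; rewrite (ltW h2) -addn1 natrD ltrD2r lt_neqAle ne.
exact: h1.
Qed.

Lemma component_bound H rho : closed_set R H -> 0 < rho ->
  big_matching H rho \/ (rho <= #|H|%:R ->
    (\sum_(x in H) deg R x)%:R <= rho ^+ 2 \/
    (\sum_(x in H) deg R x)%:R <= rho * #|H|%:R - rho ^+ 2 / 4).
Proof.
move=> cH rho0; have [r /andP[r1 r2]] := ceil_nat (ltW rho0).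
case: (boolP [forall S : {set J}, (S \subset H) ==> (#|S| + r <= #|nbhd R S| + #|H|)%N]).
  move=> /forallP hall; left.
  have [|ps [sp up p1 p2 p3]] := @hall_defect _ R H r.
    by move=> S; apply/implyP.
  by exists ps; split=> //; apply: le_trans r1 _; rewrite ler_nat.
case/forallPn => S; rewrite negb_imply -ltnNge => /andP[SH lt]; right => rh.
have NH : nbhd R S \subset H.
  by apply/subsetP => y /nbhdP[x /(subsetP SH) xH]; apply: cH.
have := sum_deg_cover R_sym cH SH.
have cQ : #|H :\: nbhd R S| = (#|H| - #|nbhd R S|)%N by rewrite cardsD (setIidPr NH).
set Q := H :\: nbhd R S in cQ *; move=> cov.
have iS : (#|S :&: Q| <= #|S|)%N by rewrite subset_leq_card // subsetIl.
have iQ : (#|S :&: Q| <= #|Q|)%N by rewrite subset_leq_card // subsetIr.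
have pH : (#|S| <= #|H|)%N by rewrite subset_leq_card.
have qH : (#|Q| <= #|H|)%N by rewrite cQ leq_subr.
have spq : (2 * #|H| + 1 <= #|S| + #|Q| + r)%N.
  by have := subset_leq_card NH; rewrite cQ; move: lt; clear; lia.
move: cov iS iQ pH qH spq rh.
move: (\sum_(_ in _) _)%N #|S :&: Q| #|S| #|Q| #|H| => s i p q h.
rewrite -!(ler_nat K) !(natrD, natrM, natrX) => cov iS iQ pH qH spq rh.
have [| | | | | | |b|b] := @cover_bound h%:R p%:R q%:R i%:R rho; rewrite ?ler0n //.
- by lra.
- by left; lra.
- by right; lra.
Qed.

Let comp k := [set y | fingraph.root R y == k].
Let N : K := #|J|%:R.

Let comp_closed k : closed_set R (comp k).
Proof.
rewrite /comp; have [->|->] := component_connect R_sym k; first by move=> x y; rewrite inE.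
exact: connect_closed.
Qed.

Let sum_h : \sum_k (#|comp k|%:R : K) = N.
Proof. by rewrite -natr_sum sum_card_components. Qed.

Let sum_e : (\sum_x deg R x)%:R = \sum_k ((\sum_(x in comp k) deg R x)%:R : K).
Proof. by rewrite (sum_deg_components R) natr_sum. Qed.

Let e_le k : (\sum_(x in comp k) deg R x)%:R <= (#|comp k|%:R : K) ^+ 2.
Proof. by rewrite -natrX ler_nat; apply: sum_deg_max. Qed.

(** By averaging, some component has degree sum above [sigma * N] times its size. Both alternatives
    of [component_bound] are below that, and so is the trivial square bound for a component smaller
    than [sigma * N]. *)
Lemma dense_component sigma : 0 < sigma -> (0 < #|J|)%N ->
  sigma * N ^+ 2 < (\sum_x deg R x)%:R ->
  exists x0, big_matching [set y | connect R x0 y] (sigma * N).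
Proof.
move=> s0 J0 dense; have N0 : 0 < N by rewrite ltr0n.
have rho0 : 0 < sigma * N by apply: mulr_gt0.
case: (boolP [forall k, ((\sum_(x in comp k) deg R x)%:R : K) <=
    sigma * N * #|comp k|%:R]).
  move=> /forallP all; exfalso; move: dense; rewrite sum_e ltNge => /negP; apply.
  apply: (@le_trans _ _ (\sum_k sigma * N * #|comp k|%:R)); first exact: ler_sum.
  by rewrite -mulr_sumr sum_h expr2 mulrA.
case/forallPn => k; rewrite -ltNge => big; exists k.
have [E|<-] := component_connect R_sym k.
  by move: big; rewrite -/(comp k) /comp E big_set0 cards0 mulr0 ltxx.
have [//|bound] := component_bound (@comp_closed k) rho0; exfalso.
case: (lerP (sigma * N) #|comp k|%:R) => h; last first.
  have := e_le k; have : 0 <= (#|comp k|%:R : K) by rewrite ler0n.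
  by move: big h; nra.
case: (bound h) => b; move: big h b; rewrite -/(comp k); nra.
Qed.

Let square_sum (P : pred J) (x : J -> K) M : (forall k, 0 <= x k) ->
  (forall k, P k -> x k <= M) ->
  \sum_(k | P k) x k ^+ 2 <= M * \sum_(k | P k) x k.
Proof.
move=> x0 xM; rewrite mulr_sumr; apply: ler_sum => k Pk.
by rewrite expr2 ler_wpM2r // xM.
Qed.

(** The threshold is the density of two disjoint cliques of relative sizes [sigma] and [1 - sigma].
    If no component qualifies, every one is [weak], and the total is bounded by this
    configuration. *)
Lemma dense_odd_component sigma : 1 / 2 <= sigma -> sigma <= 1 -> (0 < #|J|)%N ->
  (sigma ^+ 2 + (1 - sigma) ^+ 2) * N ^+ 2 < (\sum_x deg R x)%:R ->
  exists x0, connect (dbl R) (x0, false) (x0, true) /\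
    big_matching [set y | connect R x0 y] (sigma * N).
Proof.
move=> s1 s2 J0 dense; have N0 : 0 < N by rewrite ltr0n.
have rho0 : 0 < sigma * N by apply: mulr_gt0 => //; lra.
pose h k : K := #|comp k|%:R; pose e k : K := (\sum_(x in comp k) deg R x)%:R.
have h0 k : 0 <= h k by rewrite ler0n.
pose rho := sigma * N.
pose weak k := [|| 2 * e k <= h k ^+ 2, h k < rho, e k <= rho ^+ 2 |
  e k <= rho * h k - rho ^+ 2 / 4].
case: (boolP [forall k, weak k]); last first.
  case/forallPn => k; rewrite !negb_or -!ltNge -leNgt => /and4P[w1 w2 w3 w4].
  exists k; have [E|E] := component_connect R_sym k.
    by move: w1; rewrite /e /h /comp E big_set0 cards0 expr0n mulr0 ltxx.
  rewrite -E; split.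
    apply/negPn/negP => nb; have := sum_deg_bipartite R_sym nb.
    by rewrite -E -(ler_nat K) natrM natrX leNgt w1.
  have [//|bound] := component_bound (@comp_closed k) rho0; exfalso.
  by case: (bound w2); rewrite leNgt ?w3 ?w4.
move=> /forallP all; exfalso; move: dense; rewrite sum_e ltNge => /negP; apply.
have rhoN : N / 2 <= rho <= N.
  by rewrite /rho; apply/andP; split; nra.
have -> : (sigma ^+ 2 + (1 - sigma) ^+ 2) * N ^+ 2 = rho ^+ 2 + (N - rho) ^+ 2.
  by rewrite /rho; ring.
(* If all components are small, the sum of squares is at most [N ^ 2 / 2]. Otherwise one component
   is large, and the rest contributes no more than a single clique on the remaining vertices. *)
case: (boolP [forall k, h k <= N / 2]) => [/forallP small|].
  apply: (@le_trans _ _ (N / 2 * N)).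
    rewrite -[X in _ <= _ * X]sum_h; apply: le_trans (square_sum (P := xpredT) h0 _).
      by apply: ler_sum => k _; apply: e_le.
    by move=> k _; apply: small.
  by move: rhoN => /andP[]; nra.
case/forallPn => k0; rewrite -ltNge => big.
have rest : \sum_(k | k != k0) h k = N - h k0.
  by rewrite -[in RHS]sum_h [in RHS](bigD1 k0) //= addrAC subrr add0r.
have hN : h k0 <= N.
  by rewrite -subr_ge0 -rest; apply: sumr_ge0.
have hrest k : k != k0 -> h k <= N - h k0.
  move=> ne; rewrite -rest (bigD1 k) //= lerDl; exact: sumr_ge0.
rewrite (bigD1 k0) //=; apply: (@le_trans _ _ (e k0 + (N - h k0) ^+ 2)).
  rewrite lerD2l; apply: (@le_trans _ _ (\sum_(k | k != k0) h k ^+ 2)).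
    by apply: ler_sum => k _; apply: e_le.
  by rewrite expr2 -[X in _ <= _ * X]rest; apply: square_sum.
have ek := e_le k0; rewrite -/(e k0) -/(h k0) in ek.
move: rhoN => /andP[r1 r2].
case/or4P: (all k0) => w; first by nra.
- by nra.
- by case: (lerP rho (h k0)) => c; nra.
- case: (lerP rho (h k0)) => c; last by nra.
  have c1 : 0 <= (h k0 - rho) * (N - h k0) by apply: mulr_ge0; lra.
  have c2 : 0 <= (N - 3 / 2 * rho) ^+ 2 by apply: sqr_ge0.
  have c3 : 0 <= (h k0 - rho) * N by apply: mulr_ge0; lra.
  nra.
Qed.

End Extremal.

(** * From a partial injection to a matching of half blocks *)

Section Halving.

Variables (J : finType) (R : rel J) (x0 : J) (ps : seq (J * J)).
Hypothesis R_sym : symmetric R.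
Hypothesis ps_uniq : uniq ps.
Hypothesis psR : {in ps, forall p, connect R x0 p.1 /\ R p.1 p.2}.
Hypothesis ps1 : {in ps &, forall p p', p.1 = p'.1 -> p = p'}.
Hypothesis ps2 : {in ps &, forall p p', p.2 = p'.2 -> p = p'}.

Definition half_rel (u v : J * bool) := R u.1 v.1.

Let lift (u : J * bool) (h : bool) : (J * bool) * bool := ((u.1, h), u.2).

(** Halves can be chosen freely along a walk. The neighbour [w] serves the trivial walk, where
    passing from one half of a block to the other needs a detour. *)
Lemma connect_half u v h h' : (exists w, dbl R u w) -> connect (dbl R) u v ->
  connect (dbl half_rel) (lift u h) (lift v h').
Proof.
move=> [w uw] /connectP[p ep ->].
case: p ep => [_|v' p].
  apply: connect_trans (connect1 (y := lift w h) uw) (connect1 _).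
  by move: uw; rewrite /dbl /half_rel /= R_sym eq_sym.
elim: p u v' h {w uw} => [|v2 p IH] u v' h /=; first by rewrite andbT => uv; apply: connect1.
move=> /andP[uv /andP[vv ep]]; apply: connect_trans (connect1 (y := lift v' h) uv) _.
by apply: IH; rewrite /= vv.
Qed.

(* A pair [(x, y)] uses the first half of [x] and the second half of [y]; it is
   oriented so that it starts on the side of [(x0, false)] in the double cover. *)
Definition orient (p : J * J) : (J * bool) * (J * bool) :=
  if connect (dbl R) (x0, false) (p.1, false) then ((p.1, false), (p.2, true))
  else ((p.2, true), (p.1, false)).

Let start p : p \in ps -> connect (dbl R) (x0, false) ((orient p).1.1, false).
Proof.
move=> /psR[x0p Rp]; rewrite /orient; case: ifP => // no.
have [[] h] := connect_dbl x0p; last by rewrite h in no.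
apply: connect_trans h (connect1 _).
by rewrite /dbl /= Rp.
Qed.

Let finish p : p \in ps -> connect (dbl R) (x0, false) ((orient p).2.1, true).
Proof.
move=> /psR[x0p Rp]; rewrite /orient; case: ifP => [h|no].
  by apply: connect_trans h (connect1 _); rewrite /dbl /= Rp.
by have [[] h] := connect_dbl x0p; last by rewrite h in no.
Qed.

Lemma orient_rel p : p \in ps -> half_rel (orient p).1 (orient p).2.
Proof.
by move=> /psR[_ Rp]; rewrite /orient /half_rel; case: ifP; rewrite //= R_sym.
Qed.

Lemma orient1 : {in ps &, forall p p', (orient p).1 = (orient p').1 -> p = p'}.
Proof.
move=> p p' pin p'in; rewrite /orient; case: ifP => _; case: ifP => _ //= [E].
  exact: ps1.
exact: ps2.
Qed.

Lemma orient2 : {in ps &, forall p p', (orient p).2 = (orient p').2 -> p = p'}.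
Proof.
move=> p p' pin p'in; rewrite /orient; case: ifP => _; case: ifP => _ //= [E].
  exact: ps2.
exact: ps1.
Qed.

Lemma orient12 : {in ps &, forall p p', (orient p).1 != (orient p').2}.
Proof.
move=> p p' pin p'in; apply/eqP; rewrite /orient.
case: ifP => c; case: ifP => c' //= [E].
  by have E' := ps1 pin p'in E; rewrite E' c' in c.
by have E' := ps2 pin p'in E; rewrite E' c' in c.
Qed.

Lemma orient_connect p p' : p \in ps -> p' \in ps ->
  connect (dbl half_rel) ((orient p).2, true) ((orient p').1, false).
Proof.
move=> pin p'in.
have := @connect_half ((orient p).2.1, true) ((orient p').1.1, false)
  (orient p).2.2 (orient p').1.2.
rewrite /lift /= -!surjective_pairing; apply.
  by exists ((orient p).1.1, false); rewrite /dbl /= R_sym; have := orient_rel pin; rewrite /half_rel => ->.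
apply: connect_trans (start p'in); rewrite dbl_sym //; exact: finish.
Qed.

Lemma orient_connect_odd p p' : connect (dbl R) (x0, false) (x0, true) ->
  p \in ps -> p' \in ps ->
  connect (dbl half_rel) ((orient p).2, true) ((orient p').1, true).
Proof.
move=> odd_cycle pin p'in.
have := @connect_half ((orient p).2.1, true) ((orient p').1.1, true)
  (orient p).2.2 (orient p').1.2.
rewrite /lift /= -!surjective_pairing; apply.
  by exists ((orient p).1.1, false); rewrite /dbl /= R_sym; have := orient_rel pin; rewrite /half_rel => ->.
apply: (@connect_trans _ _ (x0, false)); first by rewrite dbl_sym // finish.
apply: connect_trans odd_cycle _.
exact: (dbl_flip (start p'in)).
Qed.

Lemma orient_uniq : uniq (map orient ps).
Proof.
rewrite map_inj_in_uniq // => p p' pin p'in E.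
by apply: orient1 => //; rewrite E.
Qed.

End Halving.

(** * Expander mixing *)

Section SpectralMixing.

Local Open Scope ring_scope.
Local Open Scope sesquilinear_scope.

Variables (C : numClosedFieldType) (N : nat) (A : 'M[C]_N) (s : seq C) (d l : C).
Hypothesis A_herm : A \is hermsymmx.
Hypothesis A_char : char_poly A = \prod_(x <- s) ('X - x%:P).
Hypothesis A_ones : const_mx 1 *m A = d *: const_mx 1 :> 'rV[C]_N.
Hypothesis tail_le : {in behead s, forall x, `|x| <= l}.
Hypotheses (l_ge0 : 0 <= l) (ld : l < d) (N_gt0 : (0 < N)%N).

Let P := spectralmx A.
Let D := spectral_diag A.
Let v : 'rV[C]_N := const_mx 1.

Let AE : A = P^t* *m diag_mx D *m P.
Proof.
rewrite -invmx_unitary ?spectral_unitarymx //.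
exact/orthomx_spectralP/hermitian_normalmx.
Qed.

Let PP : P^t* *m P = 1%:M.
Proof. by apply: mulmx1C; apply/unitarymxP; apply: spectral_unitarymx. Qed.

Let PP' : P *m P^t* = 1%:M.
Proof. by apply/unitarymxP; apply: spectral_unitarymx. Qed.

Let D_perm : perm_eq [seq D 0 i | i <- enum 'I_N] s.
Proof.
apply: prod_XsubC_eq; rewrite -A_char big_map big_enum /=.
have -> : char_poly A = char_poly (diag_mx D).
  rewrite /char_poly.
  have -> : char_poly_mx A = map_mx polyC (P^t* ) *m char_poly_mx (diag_mx D) *m map_mx polyC P.
    rewrite /char_poly_mx mulmxBr mulmxBl mul_mx_scalar -scalemxAl -!map_mxM -AE.
    by rewrite PP map_mx1 scalemx1.
  rewrite !det_mulmx mulrAC -det_mulmx -map_mxM PP map_mx1 det1 mul1r //.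
rewrite char_poly_trig; last exact/diag_mx_is_trig.
by apply: eq_bigr => i _; rewrite !mxE eqxx.
Qed.

Let coord (a : 'rV[C]_N) : 'rV[C]_N := a *m P^t*.

Let dot (a b : 'rV[C]_N) : C := (a *m b^t*) 0 0.

Let dotE a b : dot a b = \sum_i coord a 0 i * (coord b 0 i)^*.
Proof.
rewrite /dot; have -> : a *m b^t* = coord a *m (coord b)^t*.
  by rewrite /coord trmx_mul map_mxM trmxCK mulmxA -[a *m _ *m P]mulmxA PP mulmx1.
by rewrite mxE; apply: eq_bigr => i _; rewrite !mxE.
Qed.

Let formE a b : (a *m A *m b^t*) 0 0 = \sum_i D 0 i * (coord a 0 i * (coord b 0 i)^*).
Proof.
have -> : a *m A *m b^t* = coord a *m diag_mx D *m (coord b)^t*.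
  by rewrite /coord trmx_mul map_mxM trmxCK AE !mulmxA.
rewrite mxE; apply: eq_bigr => i _; rewrite mul_mx_diag !mxE; ring.
Qed.

Let vD i : coord v 0 i * D 0 i = d * coord v 0 i.
Proof.
have : coord v *m diag_mx D = d *: coord v.
  rewrite /coord scalemxAl -A_ones AE -!mulmxA PP' mulmx1 !mulmxA //.
move/rowP/(_ i); rewrite mul_mx_diag !mxE //.
Qed.

(** All entries of [s] but the first are bounded by [l], and the diagonal is a permutation of
    [s]. *)
Let big_eigen_uniq i j : ~~ (`|D 0 i| <= l) -> ~~ (`|D 0 j| <= l) -> i = j.
Proof.
move=> hi hj; apply/eqP/negPn/negP => ne.
have : (count (fun x : C => ~~ (`|x| <= l)%R) s <= 1)%N.
  case: (s) tail_le => [|x s'] //= t.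
  rewrite (eq_in_count (a2 := pred0)); last by move=> y /t /= ->.
  by rewrite count_pred0 addn0 leq_b1.
rewrite -(permP D_perm) count_map leqNgt => /negP; apply.
rewrite -size_filter.
have sub : {subset [:: i; j] <= [seq k <- enum 'I_N | ~~ (`|D 0 k| <= l)]}.
  by move=> k; rewrite !inE mem_filter mem_enum => /orP[] /eqP->; rewrite ?hi ?hj.
by apply: (uniq_leq_size _ sub); rewrite /= inE ne.
Qed.

(** As [l < d], exactly one eigenvalue exceeds [l], and the all-ones vector is supported on its
    coordinate; that coordinate gives the main term. The inequality of arithmetic and geometric
    means bounds the rest without square roots. *)
Lemma spectral_mixing a b :
  `|(a *m A *m b^t*) 0 0 - d * (dot a v * dot v b) / N%:R| <=
  l / 2 * (dot a a + dot b b).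
Proof.
have vv : dot v v = N%:R.
  rewrite /dot mxE (eq_bigr (fun _ => 1)) ?sumr_const ?card_ord //.
  by move=> i _; rewrite !mxE conjC1 mulr1.
have N0 : N%:R != 0 :> C by rewrite pnatr_eq0 -lt0n.
have [i0 vi0] : exists i0, coord v 0 i0 != 0.
  case: (pickP [pred i | coord v 0 i != 0]) => [i|h]; first by exists i.
  move: N0; rewrite -vv dotE big1 ?eqxx // => i _.
  by have /negPn/eqP -> := negbT (h i); rewrite mul0r.
have Di0 : D 0 i0 = d by apply: (mulfI vi0); rewrite vD mulrC.
have dl : ~~ (`|d| <= l).
  by rewrite ger0_norm ?(ltW (le_lt_trans l_ge0 ld)) // lt_geF.
have small i : i != i0 -> `|D 0 i| <= l.
  move=> ne; apply/negPn/negP => h; move/negP: ne; apply; apply/eqP.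
  by apply: big_eigen_uniq => //; rewrite Di0.
have v0 i : i != i0 -> coord v 0 i = 0.
  move=> ne; apply/eqP/negPn/negP => h; have := vD i; rewrite mulrC => /(mulIf h) E.
  by have := small i ne; rewrite E (negbTE dl).
have vs w : dot w v = coord w 0 i0 * (coord v 0 i0)^*.
  rewrite dotE (bigD1 i0) //= big1 ?addr0 // => i /v0 ->.
  by rewrite conjC0 mulr0.
have vs' w : dot v w = coord v 0 i0 * (coord w 0 i0)^*.
  by rewrite dotE (bigD1 i0) //= big1 ?addr0 // => i /v0 ->; rewrite mul0r.
have -> : (a *m A *m b^t*) 0 0 - d * (dot a v * dot v b) / N%:R =
    \sum_(i | i != i0) D 0 i * (coord a 0 i * (coord b 0 i)^*).
  rewrite formE (bigD1 i0) //= Di0 -vv !vs vs'.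
  have c0 : (coord v 0 i0)^* != 0 by rewrite conjC_eq0.
  by field; rewrite vi0 c0.
apply: le_trans (ler_norm_sum _ _ _) _.
apply: (@le_trans _ _ (\sum_(i | i != i0) l / 2 *
    (coord a 0 i * (coord a 0 i)^* + coord b 0 i * (coord b 0 i)^*))).
  apply: ler_sum => i ne; rewrite !normrM norm_conjC -!normCK.
  apply: (@le_trans _ _ (l * (`|coord a 0 i| * `|coord b 0 i|))).
    by apply: ler_wpM2r; [apply: mulr_ge0 | apply: small].
  rewrite [l / 2 * _]mulrAC -[l * (_ + _) / _]mulrA ler_wpM2l // ler_pdivlMr ?ltr0n //.
  rewrite -subr_ge0.
  have -> : `|coord a 0 i| ^+ 2 + `|coord b 0 i| ^+ 2 -
      `|coord a 0 i| * `|coord b 0 i| * 2 = (`|coord a 0 i| - `|coord b 0 i|) ^+ 2.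
    by ring.
  by rewrite real_exprn_even_ge0 // rpredB // normr_real.
rewrite -mulr_sumr ler_wpM2l ?divr_ge0 //.
rewrite !dotE -big_split /= [X in _ <= X](bigD1 i0) //= lerDr.
by rewrite addr_ge0 // mul_conjC_ge0.
Qed.

End SpectralMixing.

Section ExpanderMixing.

Local Open Scope ring_scope.
Local Open Scope sesquilinear_scope.

(** Pairs are ordered, so an edge inside the intersection counts twice, matching the bilinear form
    of the adjacency matrix. *)
Definition edge_pairs (T : finType) (e : rel T) (A B : {set T}) : {set T * T} :=
  [set p | [&& p.1 \in A, p.2 \in B & e p.1 p.2]].

Lemma sum_indicator (F : pzRingType) (T : finType) (P : pred T) :
  \sum_x (P x)%:R = #|[set x | P x]|%:R :> F.
Proof.
rewrite -sum1dep_card natr_sum [RHS]big_mkcond /=.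
by apply: eq_bigr => x _; case: (P x).
Qed.

Lemma sum_enum_val (V : nmodType) (T : finType) (F : T -> V) :
  \sum_(i < #|T|) F (enum_val i) = \sum_x F x.
Proof. by rewrite -(big_enum_val (A := T) F). Qed.

Variables (R : realType) (T : finType) (G : sgraph T) (n d : nat) (lambda : R).
Hypothesis G_ndl : ndl_graph G n d lambda.
Hypotheses (n_gt0 : (0 < n)%N) (lambda_ge0 : 0 <= lambda) (lambda_lt : lambda < d%:R).

Local Notation toC := (real_complex R).
Let A := map_mx toC (adj_mx R G).
Let ind (X : {set T}) : 'rV[R[i]]_#|T| := \row_i (enum_val i \in X)%:R.

Let AE i j : A i j = (G (enum_val i) (enum_val j))%:R.
Proof. by rewrite !mxE rmorph_nat. Qed.

Let A_herm : A \is hermsymmx.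
Proof.
apply: realsym_hermsym.
  apply/is_hermitianmxP/matrixP => i j; rewrite expr0 scale1r map_mx_id // [RHS]mxE !AE.
  by rewrite adj_sym.
by apply/mxOverP => i j; rewrite AE realn.
Qed.

Let ones_ind : const_mx 1 = ind setT.
Proof. by apply/rowP => i; rewrite !mxE inE. Qed.

Let A_ones : const_mx 1 *m A = d%:R *: const_mx 1 :> 'rV[R[i]]_#|T|.
Proof.
have [_ reg _] := G_ndl.
apply/rowP => j; rewrite !mxE mulr1.
under eq_bigr => i _ do rewrite !mxE mul1r rmorph_nat adj_sym.
rewrite (sum_enum_val (fun x => (G (enum_val j) x)%:R)) sum_indicator.
by rewrite reg.
Qed.

Let dot_ind X Y : (ind X *m (ind Y)^t*) 0 0 = #|X :&: Y|%:R.
Proof.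
rewrite mxE; under eq_bigr => i _ do rewrite !mxE conjC_nat -natrM mulnb.
rewrite (sum_enum_val (fun x => ((x \in X) && (x \in Y))%:R)) sum_indicator.
by congr (_%:R); apply: eq_card => x; rewrite !inE.
Qed.

Let form_ind X Y : (ind X *m A *m (ind Y)^t*) 0 0 = #|edge_pairs G X Y|%:R.
Proof.
rewrite mxE.
under eq_bigr => j _.
  rewrite mxE.
  under eq_bigr => i _ do rewrite AE mxE -natrM mulnb.
  rewrite (sum_enum_val (fun x => ((x \in X) && G x (enum_val j))%:R)) !mxE conjC_nat.
  over.
rewrite (sum_enum_val (fun y => (\sum_x ((x \in X) && G x y)%:R) * (y \in Y)%:R)).
under eq_bigr => y _ do rewrite big_distrl /=.
rewrite exchange_big pair_big /=.
under eq_bigr => p _ do rewrite -natrM mulnb.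
rewrite sum_indicator; congr (_%:R); apply: eq_card => p; rewrite !inE.
by rewrite -andbA [G _ _ && _]andbC.
Qed.

Lemma expander_mixing X Y :
  #|edge_pairs G X Y|%:R <=
  d%:R * #|X|%:R * #|Y|%:R / n%:R + lambda / 2 * (#|X|%:R + #|Y|%:R).
Proof.
have [Tn _ [s [[chars sort_s] s1]]] := G_ndl.
have charC : char_poly A = \prod_(x <- map toC s) ('X - x%:P).
  rewrite -map_char_poly chars rmorph_prod big_map.
  by apply: eq_bigr => x _; rewrite rmorphB /= map_polyX map_polyC.
have tail : {in behead (map toC s), forall x, `|x| <= toC lambda}.
  rewrite behead_map => _ /mapP[x xs ->].
  have -> : `|toC x| = toC `|x|.
    by rewrite normc_def /= expr0n addr0 sqrtr_sqr.
  rewrite lecR; apply: le_trans s1.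
  (* A list with fewer than two entries has an empty tail, so the default value of its second entry
     is harmless. *)
  case: (s) sort_s xs => [|a [|b s']] //= /andP[_ p]; rewrite inE => /orP[/eqP->//|xs].
  have tr : transitive (fun u w : R => `|w| <= `|u|).
    by move=> u w z h1 h2; apply: le_trans h2 h1.
  by have /allP/(_ x xs) := order_path_min tr p.
have l0 : 0 <= toC lambda by rewrite ler0c.
have dC : toC d%:R = d%:R by rewrite rmorph_nat.
have ld : toC lambda < d%:R by rewrite -dC ltcR.
have N0 : (0 < #|T|)%N by rewrite Tn.
have := spectral_mixing A_herm charC A_ones tail l0 ld N0 (ind X) (ind Y).
rewrite form_ind ones_ind !dot_ind setIT setTI !setIid Tn => h.
rewrite -lecR rmorphD /= rmorph_nat -lerBlDl.
rewrite !(rmorphM, rmorphD, fmorphV, rmorph_nat) /= -[d%:R * _ * _]mulrA.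
apply: le_trans h; apply: real_ler_norm.
by rewrite rpredB ?rpredM ?rpredV ?realn.
Qed.

End ExpanderMixing.

(** * Cycles from the reduced graph *)

Section ReducedGraph.

Variables (T : finType) (e : rel T) (J : finType) (R : rel J).
Variables (Q : J -> {set T}) (x0 : J) (ps : seq (J * J)) (m q l z c t : nat).
Hypothesis e_sym : symmetric e.
Hypothesis R_sym : symmetric R.
Hypothesis Q_disj : forall i j x, x \in Q i -> x \in Q j -> i = j.
Hypothesis RJ : forall i j, R i j -> joined e m (Q i) (Q j).
Hypothesis ps_uniq : uniq ps.
Hypothesis psR : {in ps, forall p, connect R x0 p.1 /\ R p.1 p.2}.
Hypothesis ps1 : {in ps &, forall p p', p.1 = p'.1 -> p = p'}.
Hypothesis ps2 : {in ps &, forall p p', p.2 = p'.2 -> p = p'}.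
Hypothesis t_odd : odd t -> connect (dbl R) (x0, false) (x0, true).
Hypotheses (m_gt0 : 0 < m) (q_gt1 : 1 < q) (l_even : ~~ odd l).
Hypotheses (ql_ge : m <= q ^ l) (ql_le : q ^ l <= q ^ 2 * m).
Hypothesis z_tree : 4 * q * m * q.+2 + m <= z.
Hypothesis z_link : 2 * m + size ps * (4 * #|J|) <= z.
Hypothesis Q_large : forall j, 2 * (4 * z + (c + 5 * m)) <= #|Q j|.
Hypothesis ps_gt0 : 0 < size ps.
Hypothesis t_ge : 2 * l + 4 + 4 * #|J| <= t.
Hypothesis c_ge : size ps * (2 * l + 4 + 4 * #|J|) <= 2 * c.
Hypothesis t_le : t <= 2 * c * size ps.

(** Each block is cut into two halves and the matching is lifted to them; doubling the number of
    blocks turns the walk bound into [4 * #|J|]. *)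
Let sub_cycle (ps' : seq (J * J)) : uniq ps' -> {subset ps' <= ps} ->
  0 < size ps' <= size ps -> size ps' * (2 * l + 4 + 4 * #|J|) <= t ->
  t <= 2 * c * size ps' -> exists s, size s = t /\ ucycle e s.
Proof.
move=> ups' sub /andP[ps'0 ps's] tge tle.
pose h := 4 * z + (c + 5 * m).
have /fin_all_exists[H HP] (j : J) : exists f : nat -> {set T}, forall i, i < 2 ->
    [/\ f i \subset Q j, #|f i| = nth 0 [:: h; h] i &
        forall i', i' < 2 -> i != i' -> [disjoint f i & f i']].
  apply: (@disjoint_pieces _ [:: h; h]); rewrite /= addn0 addnn -mul2n.
  exact: Q_large.
pose P (u : J * bool) := H u.1 u.2.
have b2 (b : bool) : b < 2 by case: b.
have PQ u : P u \subset Q u.1 by have [] := HP u.1 u.2 (b2 _).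
have cP u : #|P u| = h by have [_ ->] := HP u.1 u.2 (b2 _); case: (u.2).
have Pd u u' x : x \in P u -> x \in P u' -> u = u'.
  move: u u' => [j b] [j' b'] h1 h2.
  have E := Q_disj (subsetP (PQ _) _ h1) (subsetP (PQ _) _ h2).
  rewrite /= in E; rewrite -E in h2 *.
  congr (_, _); apply/eqP/negPn/negP => ne.
  have ne' : (b : nat) != b' by move: ne; case: (b); case: (b').
  have [_ _ /(_ b' (b2 _) ne')] := HP j b (b2 _).
  by move=> /disjointFr/(_ h1); rewrite /P /= in h2; rewrite h2.
have psR' : {in ps', forall p, connect R x0 p.1 /\ R p.1 p.2}.
  by move=> p /sub/psR.
have ps1' : {in ps' &, forall p p', p.1 = p'.1 -> p = p'}.
  by move=> p p' /sub h1 /sub h2; apply: ps1.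
have ps2' : {in ps' &, forall p p', p.2 = p'.2 -> p = p'}.
  by move=> p p' /sub h1 /sub h2; apply: ps2.
have mapE : exists p0 pps, map (orient R x0) ps' = p0 :: pps.
  by case: (ps') ps'0 => [|p s] //= _; exists (orient R x0 p), (map (orient R x0) s).
have [p0 [pps E]] := mapE.
have sE : size (p0 :: pps) = size ps' by rewrite -E size_map.
have inE' p : p \in p0 :: pps -> exists2 p', p' \in ps' & p = orient R x0 p'.
  by rewrite -E => /mapP.
have cJ2 : 2 * #|{: J * bool}| = 4 * #|J|.
  by rewrite card_prod card_bool; lia.
apply: (@cycle_of_matching _ e _ (half_rel R) P p0 pps m q l z c t) => //.
- move=> u v uv; apply: joinedS (RJ uv); exact: PQ.
- by rewrite -E; apply: orient_uniq.
- move=> _ _ /inE'[p pin ->] /inE'[p' p'in ->] /(orient1 ps1' ps2' pin p'in) -> //.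
- move=> _ _ /inE'[p pin ->] /inE'[p' p'in ->] /(orient2 ps1' ps2' pin p'in) -> //.
- move=> _ _ /inE'[p pin ->] /inE'[p' p'in ->]; exact: (orient12 R x0 ps1' ps2' pin p'in).
- move=> _ /inE'[p pin ->]; exact: (orient_rel R_sym psR' pin).
- move=> _ _ /inE'[p pin ->] /inE'[p' p'in ->]; exact: (orient_connect R_sym psR').
- move=> ot _ _ /inE'[p pin ->] /inE'[p' p'in ->].
  by apply: (orient_connect_odd R_sym psR') => //; apply: t_odd.
- rewrite sE cJ2; apply: leq_trans z_link; by rewrite leq_add2l leq_mul2r ps's orbT.
- by move=> u; rewrite cP.
- by rewrite sE cJ2.
- by rewrite sE.
Qed.

(* Long cycles use the whole matching, short ones a single matching edge. *)
Lemma cycle_of_reduced : exists s, size s = t /\ ucycle e s.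
Proof.
case: (leqP (size ps * (2 * l + 4 + 4 * #|J|)) t) => tge.
  by apply: (sub_cycle (ps' := ps)); rewrite ?ps_gt0 ?leqnn.
case E : ps ps_gt0 => [|p s] // _.
apply: (sub_cycle (ps' := [:: p])) => //.
- by move=> p'; rewrite inE => /eqP->; rewrite E mem_head.
- by rewrite mul1n.
(* By [c_ge] one segment already holds more than the bound that [t] fails to reach. *)
by rewrite muln1; apply: leq_trans (ltnW tge) _.
Qed.

End ReducedGraph.

Lemma even_exponent q m : 1 < q -> 0 < m ->
  exists l, [/\ ~~ odd l, m <= q ^ l & q ^ l <= q ^ 2 * m].
Proof.
move=> q1 m0; have q21 : 1 < q ^ 2 by rewrite -(exp1n 2) ltn_exp2r.
have ex : exists k, m <= (q ^ 2) ^ k.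
  by exists m; apply: ltnW (ltn_expl _ q21).
case: (ex_minnP ex) => k mk kmin; exists (2 * k); rewrite oddM expnM.
split=> //; case: k mk kmin => [|k] mk kmin.
  by rewrite expn0 muln_gt0 m0 (ltnW q21).
rewrite expnS leq_mul2l; apply/orP; right.
by rewrite leqNgt; apply/negP => /ltnW/kmin; rewrite ltnn.
Qed.

(** As [l] is at most logarithmic in [n], it suffices to compare [l.+1] with [2 ^ l./2], which is of
    order at most the square root of [n]. *)
Lemma log_small A B : exists n0, forall n l, n0 <= n -> 2 ^ l <= B * n ->
  A * l.+1 <= n.
Proof.
exists (4 * A ^ 2 * B.+1) => n l n0 lB.
have lin : l.+1 <= 2 * 2 ^ l./2.
  apply: (@leq_trans (2 * (l./2).+1)); last by rewrite leq_mul2l ltn_expl.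
  by rewrite -[in X in X <= _](odd_double_half l) -mul2n; case: (odd l); lia.
case: (leqP (2 * A * B.+1) (2 ^ l./2)) => h; last first.
  apply: leq_trans n0; move: lin h; move: (2 ^ _) => x; nia.
have sq : (2 ^ l./2) ^ 2 <= 2 ^ l.
  by rewrite -expnM leq_exp2l // muln2 -[X in _ <= X]odd_double_half leq_addl.
move: lin h sq lB; move: (2 ^ l./2) (2 ^ l) => x y.
move=> lin h sq lB.
have h1 : 2 * A * B.+1 * x <= B.+1 * n.
  apply: (@leq_trans (x ^ 2)); first by rewrite -mulnn leq_mul2r h orbT.
  apply: leq_trans sq (leq_trans lB _); by rewrite leq_mul2r leqnSn orbT.
have h2 : 2 * A * x <= n.
  by rewrite -(leq_pmul2l (ltn0Sn B)); apply: leq_trans h1; nia.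
by apply: leq_trans h2; nia.
Qed.

Section EdgeCounts.

Variable T : finType.
Implicit Types (e : rel T) (A B : {set T}) (F : {set {set T}}).

Lemma card_edge_pairs e : symmetric e -> irreflexive e ->
  #|edge_pairs e setT setT| = 2 * #|edges e|.
Proof.
move=> es ei; set E := edge_pairs e setT setT.
pose f (p : T * T) := [set p.1; p.2].
have fE p : p \in E -> f p \in edges e.
  rewrite !inE /= => exy; apply/existsP; exists p.1; apply/existsP; exists p.2.
  by rewrite exy eqxx.
rewrite -sum1_card (partition_big f (mem (edges e))) //= mulnC -sum_nat_const.
apply: eq_bigr => A; rewrite inE => /existsP[x /existsP[y /andP[exy /eqP->]]].
have xy : x != y by apply: contraTneq exy => ->; rewrite ei.
rewrite sum1dep_card.
have -> : [set p | (p \in E) && (f p == [set x; y])] = [set (x, y); (y, x)].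
  apply/setP => -[a b]; rewrite !inE /= !xpair_eqE; apply/idP/idP.
    move=> /andP[eab /eqP/setP E1].
    have ab : a != b by apply: contraTneq eab => ->; rewrite ei.
    have := E1 a; have := E1 b; rewrite !inE !eqxx orbT /= => /esym h1 /esym h2.
    case/orP: h2 => /eqP Ea; case/orP: h1 => /eqP Eb; rewrite Ea Eb ?eqxx ?orbT // in ab *.
  case/orP => /andP[/eqP-> /eqP->]; rewrite /f ?exy ?eqxx //= es exy /=.
  by apply/eqP/setP => z; rewrite !inE orbC.
by rewrite cards2 xpair_eqE negb_and xy.
Qed.

Lemma card_regular_pairs e d : regular e d -> forall A,
  #|edge_pairs e A setT| = #|A| * d.
Proof.
move=> reg A; rewrite -[LHS]sum1_card.
rewrite (eq_bigl (fun p => (p.1 \in A) && e p.1 p.2)); last by move=> p; rewrite !inE.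
rewrite -(pair_big_dep (fun x => x \in A) (fun x y => e x y) (fun _ _ => 1)) /=.
by rewrite -sum_nat_const; apply: eq_bigr => x _; rewrite sum1dep_card reg.
Qed.

Definition joined_pairs e m F : {set {set T} * {set T}} :=
  [set p in setX F F | ~~ edgeless e p.1 p.2 && joined e m p.1 p.2].

Lemma edge_pairs_blocks e' e d m F v : symmetric e -> regular e d ->
  subrel e' e -> {in F &, forall A B, #|edge_pairs e A B| <= v} ->
  #|edge_pairs e' setT setT| <=
  2 * (#|~: cover F| * d) + (#|bad_pairs e' m F| + #|joined_pairs e' m F|) * v.
Proof.
move=> es reg sub vP; set U := ~: cover F.
have c1 := card_regular_pairs reg U.
have c2 : #|edge_pairs e setT U| = #|U| * d.
  have sw : injective (fun p : T * T => (p.2, p.1)) by move=> [a b] [a' b'] [-> ->].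
  rewrite -c1 -(card_imset (mem (edge_pairs e U setT)) sw).
  apply: eq_card => -[x y]; apply/idP/imsetP => [|[[a b] h [-> ->]]].
    rewrite !inE /= => /andP[yU exy]; exists (y, x) => //.
    by rewrite !inE /= yU es.
  by move: h; rewrite !inE /= es.
pose B := bad_pairs e' m F :|: joined_pairs e' m F.
have BP p : (p \in B) = [&& p.1 \in F, p.2 \in F & ~~ edgeless e' p.1 p.2].
  by rewrite !inE; case: (edgeless _ _ _); case: (joined _ _ _ _); rewrite /= ?andbF ?andbT ?orbF ?orbb.
pose E := \bigcup_(p in B) edge_pairs e p.1 p.2.
have cE : #|E| <= #|B| * v.
  apply: (@leq_trans (\sum_(p in B) #|edge_pairs e p.1 p.2|)).
    rewrite /E; elim/big_rec2: _ => [|p a b _ h]; first by rewrite cards0.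
    by apply: leq_trans (leq_cardsU _ _) _; rewrite leq_add2l.
  rewrite -sum_nat_const; apply: leq_sum => p; rewrite BP => /and3P[h1 h2 _].
  exact: vP.
apply: (@leq_trans #|edge_pairs e U setT :|: edge_pairs e setT U :|: E|).
  apply/subset_leq_card/subsetP => -[x y]; rewrite in_setU in_setU !inE /= => exy.
  rewrite (sub _ _ exy) andbT.
  case: (boolP (x \in cover F)) => //= /bigcupP[A AF xA].
  case: (boolP (y \in cover F)) => //= /bigcupP[A' AF' yA].
  apply/bigcupP; exists (A, A'); last by rewrite !inE /= xA yA sub.
  rewrite BP AF AF' /=; apply/negP => /edgelessP/(_ x y xA yA).
  by rewrite exy.
apply: leq_trans (leq_cardsU _ _) _; apply: leq_add.
  apply: leq_trans (leq_cardsU _ _) _; by rewrite c1 c2 mul2n addnn.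
apply: leq_trans cE _; rewrite leq_mul2r leq_cardsU orbT //.
Qed.

End EdgeCounts.

(** * Numerical thresholds *)

Section Thresholds.

Variable R : realType.
Implicit Types (beta sigma : R) (t n : nat).

Local Open Scope ring_scope.

Lemma natr_bin2 n : 2 * 'C(n, 2)%:R = n%:R * (n%:R - 1) :> R.
Proof.
case: n => [|n]; first by rewrite bin0n mulr0 mul0r.
have : (2 * 'C(n.+1, 2) = n.+1 * n)%N.
  by rewrite bin2 mul2n -[RHS]odd_double_half oddM /= andNb.
by move/(congr1 (fun k => k%:R : R)); rewrite !natrM -[in n.+1%:R - 1]natr1 addrK.
Qed.

Lemma natr_divn_ge (a b : nat) : (0 < b)%N -> a%:R / b%:R <= (a %/ b + 1)%:R :> R.
Proof.
by move=> b0; rewrite ler_pdivrMr ?ltr0n // -natrM ler_nat addn1 ltnW // ltn_ceil.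
Qed.

(** The number [sigma] is the relative matching size to aim for. The first alternative feeds
    [dense_odd_component] and also covers large even [t], where [g] has the same value as for odd
    [t]; the second feeds [dense_component]. *)
Lemma target_density beta t n : 0 < beta -> beta < 1 / 4 ->
  1000 / beta <= n%:R -> t%:R <= (1 - beta) * n%:R ->
  exists sigma, [/\ t%:R / n%:R + beta / 8 <= sigma, 0 < sigma, sigma <= 1 &
    (1 / 2 <= sigma /\
       sigma ^+ 2 + (1 - sigma) ^+ 2 < g (beta / 8) t n + 9 / 10 * beta) \/
    (~~ odd t /\ sigma < g (beta / 8) t n + 9 / 10 * beta)].
Proof.
move=> b0 b4 nb tn.
have n1000 : 4000 < n%:R :> R.
  by apply: lt_le_trans nb; rewrite ltr_pdivlMr //; lra.
have n0 : 0 < n%:R :> R by lra.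
have invn : 1 / n%:R <= beta / 1000.
  by rewrite ler_pdivrMr // mulrAC ler_pdivlMr ?ltr0n // mul1r mulrC -ler_pdivrMr.
set tau := t%:R / n%:R.
have tE : t%:R = tau * n%:R by rewrite /tau divfK // gt_eqF.
have tau0 : 0 <= tau by rewrite divr_ge0.
have tau1 : tau <= 1 - beta by rewrite ler_pdivrMr.
have tn' : (t <= n)%N.
  by rewrite -(ler_nat R); apply: le_trans tn _; rewrite ler_piMl; lra.
have binE := natr_bin2 n.
have bin0 : 0 < 'C(n, 2)%:R :> R by nra.
have gE x : x <= g (beta / 8) t n <-> x * (n%:R * (n%:R - 1)) <= 2 * (g_num (beta / 8) t n)%:R.
  by rewrite /g ler_pdivlMr // -binE mulrCA ler_pM2l ?ltr0n.
have big : (n%:R + 3) / 2 <= t%:R :> R -> g_num (beta / 8) t n = ('C(t - 1, 2) + 'C(n + 2 - t, 2) + 1)%N.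
  by move=> h; rewrite /g_num h; case: ifP.
have [h|h] := lerP ((n%:R + 3) / 2) (t%:R : R).
  have t1 : (1 <= t)%N by rewrite -(ltr_nat R); lra.
  have glow : tau ^+ 2 + (1 - tau) ^+ 2 - 3 / n%:R <= g (beta / 8) t n.
    apply/gE.
    have -> : 2 * (g_num (beta / 8) t n)%:R = (t%:R - 1) * (t%:R - 1 - 1) +
        (n%:R + 2 - t%:R) * (n%:R + 2 - t%:R - 1) + 2 :> R.
      rewrite big // 2!natrD 2!mulrDr !natr_bin2 !natrB ?natrD ?mulr1 //.
      by apply: leq_trans tn' (leq_addr _ _).
    have -> : (tau ^+ 2 + (1 - tau) ^+ 2 - 3 / n%:R) * (n%:R * (n%:R - 1)) =
       (t%:R ^+ 2 + (n%:R - t%:R) ^+ 2) * (n%:R - 1) / n%:R - 3 * (n%:R - 1).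
      by rewrite tE; field; rewrite gt_eqF.
    have : (t%:R ^+ 2 + (n%:R - t%:R) ^+ 2) * (n%:R - 1) / n%:R <=
       t%:R ^+ 2 + (n%:R - t%:R) ^+ 2 :> R.
      rewrite ler_pdivrMr // ler_wpM2l ?addr_ge0 ?sqr_ge0 //; lra.
    have tn'' : t%:R <= n%:R :> R by rewrite ler_nat.
    move: tn''; move: (n%:R : R) (t%:R : R) => x y xy; nra.
  have half : 1 / 2 <= tau by rewrite ler_pdivlMr //; lra.
  clear -b0 b4 half tau1 invn glow n0.
  (* On the interval from 1/2 to 1 the two-clique density has slope at most 2, so this shift costs
     at most [beta / 4]. *)
  exists (tau + beta / 8); split; [lra|lra|lra|left; split; first lra].
  have : 3 / n%:R <= 3 * (beta / 1000) by rewrite -[3 / _]mulr1 mulrAC -mulrA ler_pM2l //; lra.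
  have : (4 * tau - 2) * (beta / 8) <= 2 * (beta / 8) by rewrite ler_wpM2r //; lra.
  have : (beta / 8) ^+ 2 <= beta / 8 by rewrite expr2 ler_piMr; lra.
  move: glow; set G := g _ _ _; nra.
have tau_half : tau < 1 / 2 + 2 * (1 / n%:R).
  have E : (1 / 2 + 2 * (1 / n%:R)) * n%:R = n%:R / 2 + 2 :> R by field; rewrite gt_eqF.
  by rewrite ltr_pdivrMr // E; lra.
case: (boolP (odd t)) => ot.
  have glow : 1 / 2 <= g (beta / 8) t n.
    apply/gE; rewrite /g_num ot (lt_geF h) /=.
    have := @natr_divn_ge (n ^ 2) 4 isT; rewrite natrX => h4.
    nra.
  clear -b0 b4 tau_half invn glow.
  (* The two-clique density exceeds 1/2 here by only [beta ^+ 2 / 8]. *)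
  exists (1 / 2 + beta / 4); split; [lra|lra|lra|left; split; first lra].
  nra.
have [gt|gt] := lerP (beta / 8 * n%:R) (t%:R : R).
  have t1 : (1 <= t)%N.
    rewrite -(ltr_nat R); apply: lt_le_trans gt; apply: mulr_gt0 => //; lra.
  have glow : tau - 1 / n%:R <= g (beta / 8) t n.
    apply/gE; rewrite /g_num (negbTE ot) (lt_geF h) gt /=.
    have := @natr_divn_ge (n * (t - 1)) 2 isT; rewrite natrM natrB //.
    have -> : (tau - 1 / n%:R) * (n%:R * (n%:R - 1)) = (t%:R - 1) * (n%:R - 1).
      by rewrite tE; field; rewrite gt_eqF.
    have t1' : 1 <= t%:R :> R by rewrite (ler_nat R 1).
    nra.
  clear -b0 b4 tau0 tau1 invn glow ot.
  exists (tau + beta / 2); split; [lra|lra|lra|right; split=> //].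
  lra.
have g0 : g (beta / 8) t n = 0.
  by rewrite /g /g_num (negbTE ot) (lt_geF h) (lt_geF gt) mul0r.
clear -b0 b4 n0 gt g0 ot.
(* Here [g] vanishes and [beta] alone supplies the density; [t / n] is below [beta / 8]. *)
exists (beta / 2); split; [|lra|lra|right; split=> //].
  have : tau < beta / 8 by rewrite ltr_pdivrMr.
  lra.
rewrite g0; lra.
Qed.

(* [E] is twice the number of edges of the subgraph, [u] the number of
   uncovered vertices, [a] and [D] the numbers of bad and joined ordered pairs
   of blocks and [v] the maximal number of edges between two blocks. *)
Lemma reduced_density (E gm beta n d k M u a D lam b v : R) :
  0 < n -> 0 < d -> 0 < k -> 0 <= M -> 0 <= D -> 0 <= a -> 0 <= lam -> 1000 / beta <= b -> 0 < beta -> beta < 1 / 4 ->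
  (gm + beta) * (n * d) <= E ->
  E <= 2 * (u * d) + (a + D) * v -> b * u <= n -> b * a <= k ^+ 2 ->
  D <= k ^+ 2 -> k * M <= n -> b * (lam * k) <= d ->
  v <= d * M * M / n + lam * M ->
  (gm + 9 / 10 * beta) * k ^+ 2 <= D.
Proof.
move=> n0 d0 k0 M0 D0 a0 lam0 bb be0 be4 hE1 hE2 hu ha hD hkM hlam hv.
have b4 : 4000 < b by apply: lt_le_trans bb; rewrite ltr_pdivlMr //; lra.
have b0 : 0 < b by move: b4; clear; lra.
have bbe : 1000 <= b * beta by rewrite -ler_pdivrMr.
have k20 : 0 < k ^+ 2 by rewrite exprn_gt0.
(* Summed over [k ^+ 2] pairs of blocks, the mixing bound exceeds the true total [d * n] by a factor
   of at most [1 + 1 / b]. *)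
have vk : v * k ^+ 2 <= d * n * (1 + 1 / b).
  apply: (@le_trans _ _ ((d * M * M / n + lam * M) * k ^+ 2)).
    by rewrite ler_wpM2r // ltW.
  have -> : (d * M * M / n + lam * M) * k ^+ 2 = d * (k * M) * ((k * M) / n) + (lam * k) * (k * M).
    by field; rewrite gt_eqF.
  have h1 : d * (k * M) * ((k * M) / n) <= d * n.
    have kM0 : 0 <= k * M by apply: mulr_ge0 => //; apply: ltW.
    have : k * M / n <= 1 by rewrite ler_pdivrMr // mul1r.
    move=> h; apply: (@le_trans _ _ (d * (k * M))).
      by rewrite ler_piMr // mulr_ge0 // ltW.
    by rewrite ler_pM2l.
  have h2 : lam * k * (k * M) <= d / b * n.
    apply: ler_pM => //; [by apply: mulr_ge0 => //; apply: ltW|by apply: mulr_ge0 => //; apply: ltW|].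
    by rewrite ler_pdivlMr // mulrC.
  have -> : d * n * (1 + 1 / b) = d * n + d / b * n by field; rewrite gt_eqF.
  lra.
have aD : (a + D) * (v * k ^+ 2) <= (a + D) * (d * n * (1 + 1 / b)).
  by rewrite ler_wpM2l // addr_ge0.
have main : (gm + beta) * k ^+ 2 * (n * d) <=
    (2 * (u / n) * k ^+ 2 + (a + D) * (1 + 1 / b)) * (n * d).
  have -> : (2 * (u / n) * k ^+ 2 + (a + D) * (1 + 1 / b)) * (n * d) =
    2 * (u * d) * k ^+ 2 + (a + D) * (d * n * (1 + 1 / b)).
    by field; rewrite !gt_eqF.
  apply: le_trans (_ : E * k ^+ 2 <= _).
    by rewrite mulrAC ler_wpM2r // ltW.
  apply: (@le_trans _ _ ((2 * (u * d) + (a + D) * v) * k ^+ 2)).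
    by rewrite ler_wpM2r // ltW.
  rewrite mulrDl -[(a + D) * v * _]mulrA; lra.
rewrite ler_pM2r in main; last by apply: mulr_gt0.
have un : u / n <= 1 / b by rewrite ler_pdivrMr // mulrAC mul1r ler_pdivlMr // mulrC.
have ak : a <= 1 / b * k ^+ 2 by rewrite mulrAC mul1r ler_pdivlMr // mulrC.
have ib : 1 / b <= beta / 1000.
  by rewrite ler_pdivrMr // mulrAC ler_pdivlMr ?ltr0n // mul1r mulrC.
have ib0 : 0 < 1 / b by apply: divr_gt0.
have q1 : 2 * (u / n) * k ^+ 2 <= 2 * (beta / 1000) * k ^+ 2.
  by rewrite (ler_wpM2r (ltW k20)) //; move: un ib; clear; lra.
have q2 : a <= beta / 1000 * k ^+ 2.
  by apply: le_trans ak _; rewrite ler_wpM2r // ltW.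
have q3 : (a + D) * (1 / b) <= (2 * k ^+ 2) * (beta / 1000).
  apply: ler_pM => //; [by apply: addr_ge0|exact: ltW|].
  have : beta / 1000 * k ^+ 2 <= 1 * k ^+ 2.
    by rewrite (ler_wpM2r (ltW k20)) //; move: be0 be4; clear; lra.
  by move: q2 hD; clear; lra.
rewrite mulrDr mulr1 in main.
have bk : 0 < beta * k ^+ 2 by apply: mulr_gt0.
by move: main q1 q2 q3 bk; clear; lra.
Qed.

End Thresholds.

Section BlockGraph.

Variables (T : finType) (e : rel T) (m : nat) (F : {set {set T}}).
Hypothesis e_sym : symmetric e.

Definition block := {A : {set T} | A \in F}.

Definition block_rel : rel block := fun i j =>
  ~~ edgeless e (val i) (val j) && joined e m (val i) (val j).

Lemma block_rel_sym : symmetric block_rel.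
Proof.
have imp A B : ~~ edgeless e A B && joined e m A B -> ~~ edgeless e B A && joined e m B A.
  move=> /andP[ne /joined_sym -> //]; rewrite andbT; apply: contra ne.
  move=> /edgelessP el; apply/edgelessP => x y xA yB; rewrite e_sym; exact: el.
by move=> i j; apply/idP/idP; apply: imp.
Qed.

Lemma card_block : #|{: block}| = #|F|.
Proof. by rewrite card_sig; apply: eq_card. Qed.

Lemma joined_pairs_deg : #|joined_pairs e m F| <= \sum_i deg block_rel i.
Proof.
have -> : \sum_i deg block_rel i = \sum_(i in [set: block]) deg block_rel i.
  by apply: eq_bigl => i; rewrite inE.
rewrite sum_deg; set S := [set p | _].
apply: leq_trans (leq_imset_card (fun p : block * block => (val p.1, val p.2)) S).
apply/subset_leq_card/subsetP => -[A B]; rewrite inE => /andP[].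
rewrite inE /= => /andP[AF BF] h; apply/imsetP.
by exists (Sub A AF, Sub B BF); rewrite ?inE ?SubK.
Qed.

Lemma deg_block_le : \sum_i deg block_rel i <= #|F| ^ 2.
Proof.
rewrite -mulnn -card_block -sum_nat_const; apply: leq_sum => i _.
exact: max_card.
Qed.

End BlockGraph.

(** With X the ratio of [ln n] to [ln (1 / beta)], the depth [l] is at most X + 2. So the two trees
    take 2X of the available 4X, and the other 2X absorbs the constants once X is at least
    [4 + 2 * N]. *)
Lemma walk_bound (R : realType) (beta : R) (q l m n N k t : nat) :
  (0 < beta)%R -> (beta < 1 / 4)%R -> (1 / beta <= q%:R)%R ->
  q ^ l <= q ^ 2 * m -> m <= n -> 0 < n -> k <= N ->
  ((4 + 2 * N)%:R * ln (1 / beta) <= ln (n%:R : R))%R ->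
  (4 / ln (1 / beta) * ln n%:R <= t%:R)%R ->
  2 * l + 4 + 4 * k <= t.
Proof.
move=> be0 be4 qb ql mn n0 kN big ht.
have ib1 : (1 < 1 / beta)%R by rewrite ltr_pdivlMr //; lra.
have Lb0 : (0 < ln (1 / beta))%R by rewrite ln_gt0.
have q0 : (0 < q%:R :> R)%R by apply: lt_le_trans qb; apply: lt_trans ib1.
have Lq : (ln (1 / beta) <= ln q%:R)%R.
  by rewrite ler_ln ?posrE //; apply: lt_trans ib1.
have n0R : (0 < n%:R :> R)%R by rewrite ltr0n.
have hl : (l%:R * ln (q%:R : R) <= 2 * ln q%:R + ln n%:R)%R.
  have := leq_trans ql (leq_mul (leqnn (q ^ 2)) mn).
  rewrite -(ler_nat R) natrM !natrX => h.
  have : (ln ((q%:R : R) ^+ l) <= ln ((q%:R : R) ^+ 2 * n%:R))%R.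
    by rewrite ler_ln ?posrE // ?mulr_gt0 ?exprn_gt0.
  rewrite lnM ?posrE ?exprn_gt0 // !lnXn // -[(ln _ *+ l)%R]mulr_natl.
  by rewrite -[(ln _ *+ 2)%R]mulr_natl.
set X := (ln n%:R / ln (1 / beta))%R.
have XE : (ln n%:R = X * ln (1 / beta))%R by rewrite divfK // gt_eqF.
have ht' : (4 * X <= t%:R)%R by rewrite /X mulrA mulrAC.
have X1 : ((4 + 2 * N)%:R <= X)%R by rewrite ler_pdivlMr.
have X2 : (l%:R - 2 <= X)%R.
  rewrite ler_pdivlMr //; case: (lerP (l%:R - 2 : R) 0) => h.
    apply: (@le_trans _ _ 0%R); last first.
      by apply: Order.le_trans big; apply: mulr_ge0 => //; apply: ltW.
    by rewrite mulr_le0_ge0 // ltW.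
  apply: (@le_trans _ _ ((l%:R - 2) * ln q%:R)%R).
    by rewrite ler_wpM2l // ltW.
  by rewrite mulrBl lerBlDl.
rewrite -(ler_nat R) 2!natrD !natrM.
have kN' : (k%:R <= N%:R :> R)%R by rewrite ler_nat.
move: X1; rewrite natrD natrM => X1.
move: ht' X1 X2 kN'; clear; lra.
Qed.

Local Open Scope ring_scope.

(** The reserved pieces take a [9 / b] share of each half block and the uncovered vertices a [1 / b]
    share of all vertices; [10 / b] is far below the surplus [beta / 8] of [sigma]. *)
Lemma capacity_bound (R : realType) (beta sigma n t k b z r : R) :
  0 < beta -> 0 < n -> 0 <= z -> 0 < sigma -> sigma <= 1 -> 10 <= b -> 1000 / beta <= b ->
  t / n + beta / 8 <= sigma -> sigma * k <= r ->
  (1 - 1 / b) * n <= k * (2 * (b * z)) ->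
  t <= 2 * ((b - 9) * z) * r.
Proof.
move=> be0 n0 z0 s0 s1 b10 bb ts kr cov.
have b0 : 0 < b by lra.
have E1 : t <= (sigma - beta / 8) * n.
  by rewrite -ler_pdivrMr // lerBrDr.
have E2 : 2 * ((b - 9) * z) * (sigma * k) <= 2 * ((b - 9) * z) * r.
  by apply: ler_wpM2l => //; apply: mulr_ge0 => //; apply: mulr_ge0 => //; lra.
apply: le_trans E2; apply: le_trans E1 _.
have c0 : 0 <= (b - 9) / b * sigma by apply: mulr_ge0; [apply: divr_ge0|]; lra.
have E3 := ler_wpM2l c0 cov.
have -> : 2 * ((b - 9) * z) * (sigma * k) = (b - 9) / b * sigma * (k * (2 * (b * z))).
  by field; rewrite gt_eqF.
apply: le_trans E3; rewrite mulrA ler_wpM2r ?(ltW n0) //.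
have ib : 1 / b <= beta / 1000.
  by rewrite ler_pdivrMr // mulrAC ler_pdivlMr ?ltr0n // mul1r mulrC -ler_pdivrMr.
have -> : (b - 9) / b * sigma * (1 - 1 / b) = sigma - sigma * (10 * (1 / b)) + 9 * sigma * (1 / b) ^+ 2.
  by field; rewrite gt_eqF.
have sq : 0 <= 9 * sigma * (1 / b) ^+ 2 by rewrite mulr_ge0 ?sqr_ge0 ?mulr_ge0 // ltW.
have ib0 : 0 <= 1 / b by apply: divr_ge0 => //; apply: ltW.
have : sigma * (10 * (1 / b)) <= 1 * (10 * (1 / b)) by apply: ler_wpM2r => //; apply: mulr_ge0.
move: sq ib be0; clear; lra.
Qed.

Lemma subgraph_irrefl (T : finType) (G : sgraph T) (G' : subgraph G) : irreflexive G'.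
Proof.
by move=> x; apply/negP => /sub_adj_sub; rewrite adj_irrefl.
Qed.

Theorem corollary1p12 (R : realType) :
  exists C1 C2 : R, 0 < C1 /\ 0 < C2 /\
  forall beta : R, 0 < beta -> beta < 1 / 4 ->
  exists (n0 : nat) (gamma eta : R), (0 < n0)%N /\ 0 < gamma /\ 0 < eta /\
  forall n : nat, (n0 <= n)%N ->
  forall (d : nat) (lambda : R), (0 < d)%N -> 0 < lambda ->
  d%:R / lambda >= 1 / eta ->
  forall (T : finType) (G : sgraph T), ndl_graph G n d lambda ->
  forall t : nat,
  C1 / ln (1 / beta) * ln n%:R <= t%:R ->
  t%:R <= (1 - C2 * beta) * n%:R ->
  forall G' : subgraph G,
  #|edges G'|%:R >= (g gamma t n + beta) * #|edges G|%:R ->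
  has_cycle G' t.
Proof.
(* The 4 serves [walk_bound]; the 1 keeps [t / n] at distance [beta] from 1, so that [sigma] stays
   at most 1. *)
exists 4, 1; split=> //; split=> // beta be0 be4.
have [b bb] : exists b : nat, 1000 / beta <= b%:R.
  have h : 0 <= 1000 / beta by rewrite divr_ge0 // ltW.
  by exists (Num.bound (1000 / beta)); apply: ltW (archi_boundP h).
have b4R : 4000 < b%:R :> R by apply: lt_le_trans bb; rewrite ltr_pdivlMr //; lra.
have b4 : (4000 < b)%N by rewrite -(ltr_nat R).
(* In units of [m], this meets the tree capacity for branching [b]; a block will consist of two
   halves of [b * zq * m] vertices. *)
pose zq := (4 * b * b.+2 + 2)%N.
pose w := (2 * (b * zq))%N.
have b1 : (1 < b)%N by apply: leq_trans b4.
have b0 : (0 < b)%N by apply: leq_trans b4.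
have zq0 : (0 < zq)%N by rewrite /zq addn2.
have w0 : (0 < w)%N by rewrite /w !muln_gt0 b0 zq0.
have [N0 [n1 part]] := joined_partition b1 b0 w0.
pose N := N0.+1.
have [n2 logs] := log_small (N ^ 3 * (4 + 4 * N)) (b ^ 2).
(* This makes the ratio of [ln n] to [ln (1 / beta)] at least [4 + 2 * N]. *)
have [n3 n3P] : exists n3 : nat, sequences.expR ((4 + 2 * N)%:R * ln (1 / beta)) <= n3%:R.
  have h : 0 <= sequences.expR ((4 + 2 * N)%:R * ln (1 / beta)) by apply: expR_ge0.
  by eexists; apply: ltW (archi_boundP h).
pose n0 := maxn n1 (maxn n2 (maxn n3 (maxn (4 * N ^ 4) b))).
(* This [eta] gives [b * N * lambda <= d]: over all pairs of blocks, the mixing errors add up to at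
   most a [1 / b] share of [d * n]. *)
exists n0, (beta / 8), (1 / (b%:R * N%:R)).
have bR0 : 0 < b%:R :> R by rewrite ltr0n.
have NR0 : 0 < N%:R :> R by rewrite ltr0n.
split; first by rewrite /n0 !leq_max b0 !orbT.
split; first by apply: divr_gt0.
split; first by apply: divr_gt0 => //; apply: mulr_gt0.
move=> n; rewrite !geq_max => /andP[n1n /andP[n2n /andP[n3n /andP[n4n bn]]]].
move=> d lambda d0 lam0 dlam T G Gndl t tlow thigh G' edgesG'.
have n_gt0 : (0 < n)%N by apply: leq_trans b0 bn.
have [Tn reg _] := Gndl.
have e_sym : symmetric G' := @sub_adj_sym _ _ G'.
have G_sym : symmetric G := @adj_sym _ G.
have [|m [F [/and3P[m0 mT TN] tF cF uF badF]]] := part T (sub_adj G'); first by rewrite Tn.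
rewrite Tn in mT TN uF.
have nNm : (n <= N * m)%N by apply: leq_trans TN _; rewrite leq_mul2r leqnSn orbT.
pose k := #|F|; pose J := block F.
have cardF : #|cover F| = (k * (w * m))%N.
  rewrite -(eqP tF) (eq_bigr (fun _ => (w * m)%N)) ?sum_nat_const //.
have kMn : (k * (w * m) <= n)%N by rewrite -cardF -Tn max_card.
have kN : (k <= N)%N.
  rewrite -(leq_pmul2r m0); apply: leq_trans nNm; apply: leq_trans kMn.
  by rewrite leq_mul2l leq_pmull ?orbT.
have covn : (#|cover F| + #|~: cover F| = n)%N by rewrite cardsC Tn.
have k0 : (0 < k)%N.
  rewrite lt0n; apply/eqP => k0; rewrite cardF k0 mul0n add0n in covn.
  by move: uF; rewrite covn leqNgt ltn_Pmull.
have n0R : 0 < n%:R :> R by rewrite ltr0n.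
have d0R : 0 < d%:R :> R by rewrite ltr0n.
have k0R : 0 < k%:R :> R by rewrite ltr0n.
have lamd : b%:R * (lambda * N%:R) <= d%:R.
  by move: dlam; rewrite !div1r invrK ler_pdivlMr // [lambda * _]mulrC mulrA.
have lamd1 : lambda < d%:R.
  apply: lt_le_trans lamd; rewrite mulrCA ltr_pMr // -natrM ltr1n.
  by apply: leq_trans b1 _; rewrite leq_pmulr.
pose M := (w * m)%N.
pose V : R := d%:R * M%:R * M%:R / n%:R + lambda * M%:R.
have V0 : 0 <= V by rewrite addr_ge0 ?divr_ge0 ?mulr_ge0 ?ler0n ?ltW.
have mix : {in F &, forall A B : {set T}, (#|edge_pairs G A B| <= Num.truncn V)%N}.
  move=> A B AF BF; rewrite truncn_ge_nat //.
  have := expander_mixing Gndl n_gt0 (ltW lam0) lamd1 A B.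
  by rewrite !cF // -/M -mulr2n -[M%:R *+ 2]mulr_natl mulrA divfK // pnatr_eq0.
have cnt := edge_pairs_blocks m G_sym reg (@sub_adj_sub _ _ G') mix.
pose Rb := @block_rel T (sub_adj G') m F.
have Rsym : symmetric Rb by apply: block_rel_sym.
pose D := (\sum_i deg Rb i)%N.
have bnR : 1000 / beta <= n%:R by apply: le_trans bb _; rewrite ler_nat.
have [|sigma [s1 s2 s3 sP]] := target_density be0 be4 bnR (t := t).
  by move: thigh; rewrite mul1r.
have dens : (g (beta / 8) t n + 9 / 10 * beta) * k%:R ^+ 2 <= D%:R.
  apply: (@reduced_density R (#|edge_pairs G' setT setT|)%:R _ beta n%:R d%:R k%:R M%:R
     #|~: cover F|%:R #|bad_pairs (sub_adj G') m F|%:R D%:R lambda b%:R (Num.truncn V)%:R) => //.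
  - exact: ltW.
  - have hG : (#|edge_pairs G setT setT|)%:R = n%:R * d%:R :> R.
      by rewrite (card_regular_pairs reg) cardsT Tn natrM.
    rewrite -hG (card_edge_pairs G_sym (@adj_irrefl _ G)).
    rewrite (card_edge_pairs e_sym (@subgraph_irrefl _ _ G')) !natrM mulrCA.
    by rewrite ler_pM2l ?ltr0n.
  - move: cnt; rewrite -(ler_nat R) !(natrD, natrM) => cnt; apply: le_trans cnt _.
    rewrite lerD2l ler_wpM2r ?ler0n // lerD2l ler_nat; exact: joined_pairs_deg.
  - by rewrite -natrM ler_nat.
  - by rewrite -natrM -natrX ler_nat.
  - by rewrite -natrX ler_nat; apply: deg_block_le.
  - by rewrite -natrM ler_nat.
  - apply: le_trans lamd; rewrite ler_pM2l // ler_pM2l // ler_nat //.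
  - by have /andP[] := truncn_itv V0.
have cJ : #|{: J}| = k by apply: card_block.
have J0 : (0 < #|{: J}|)%N by rewrite cJ.
have [x0 [[ps [psr ups psR ps1 ps2]] xodd]] : exists x0 : J,
    big_matching Rb [set y | connect Rb x0 y] (sigma * k%:R) /\
    (odd t -> connect (dbl Rb) (x0, false) (x0, true)).
  case: sP => [[half sP]|[ev sP]].
    have [|x0 [h1 h2]] := @dense_odd_component R _ _ Rsym _ half s3 J0.
      by rewrite cJ; apply: lt_le_trans dens; rewrite ltr_pM2r ?exprn_gt0.
    by exists x0; rewrite -cJ.
  have [|x0 h2] := @dense_component R _ _ Rsym _ s2 J0.
    by rewrite cJ; apply: lt_le_trans dens; rewrite ltr_pM2r ?exprn_gt0.
  by exists x0; rewrite -cJ (negbTE ev).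
have [l [l_even lq1 lq2]] := even_exponent b1 m0.
have ps0 : (0 < size ps)%N.
  by rewrite -(ltr_nat R); apply: lt_le_trans psr; apply: mulr_gt0.
have psk : (size ps <= N ^ 2)%N.
  apply: (@leq_trans (k ^ 2)); last by rewrite leq_exp2r.
  by rewrite -(card_uniqP ups) -mulnn -cJ -card_prod max_card.
pose z := (zq * m)%N.
(* Of the [b * z] vertices of a half block, [4 * z] go to trees and links and [5 * m], at most
   [5 * z], to the slack of the search. *)
pose c := ((b - 9) * z)%N.
have tbound : (2 * l + 4 + 4 * k <= t)%N.
  apply: (@walk_bound R beta b l m n N k t) => //.
    by apply: le_trans bb; rewrite ler_pM2r ?invr_gt0 // ler1n.
  rewrite -[X in X <= _]expRK ler_ln ?posrE ?expR_gt0 //.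
  by apply: le_trans n3P _; rewrite ler_nat.
have mz : (m <= z)%N by rewrite leq_pmull.
(* The depth [l] is logarithmic in [n], whereas [m] is at least [n / N]. *)
have lN : (N ^ 2 * (2 * l + 4 + 4 * k) <= m)%N.
  have h : (N ^ 3 * (4 + 4 * N) * l.+1 <= n)%N.
    apply: logs n2n _; apply: (@leq_trans (b ^ l)).
      by case: (l) => // l'; rewrite leq_exp2r.
    by apply: leq_trans lq2 _; rewrite leq_mul2l mT orbT.
  have N_gt0 : (0 < N)%N by [].
  rewrite -(leq_pmul2l N_gt0); apply: leq_trans (leq_trans h nNm).
  rewrite [(N * _)%N]mulnA -expnS -mulnA leq_mul2l; apply/orP; right.
  by move: kN; clear; nia.
have z3 : (3 * m <= z)%N.
  by rewrite /z leq_mul2r /zq; apply/orP; right; move: b4; clear; nia.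
have cz : (m <= c)%N.
  by apply: leq_trans mz _; rewrite leq_pmull // subn_gt0; apply: leq_trans b4.
have NkN : (size ps * (4 * k) <= N ^ 2 * (2 * l + 4 + 4 * k))%N.
  by apply: leq_mul => //; rewrite leq_addl.
have wz : (w * m = 2 * (b * z))%N by rewrite /w /z !mulnA.
have [|||||||||s [ss us]] := @cycle_of_reduced T (sub_adj G') J Rb val x0 ps m b l z c t
   e_sym Rsym _ _ ups _ ps1 ps2 xodd m0 b1 l_even lq1 lq2 _ _ _ ps0 _ _ _.
- move=> i j x xi xj; apply: val_inj.
  by rewrite -(def_pblock tF (valP i) xi) (def_pblock tF (valP j) xj).
- by move=> i j /andP[].
- by move=> p /psR[]; rewrite inE.
- rewrite /z /zq; clear; nia.
- rewrite cJ; apply: leq_trans z3; rewrite -[3%N]/(2 + 1)%N mulnDl mul1n leq_add2l.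
  exact: leq_trans NkN lN.
- move=> j; rewrite (cF _ (valP j)) wz /c; move: b4 mz; clear; nia.
- by rewrite cJ.
- rewrite cJ; apply: leq_trans (leq_mul psk (leqnn _)) _.
  apply: leq_trans lN _; apply: leq_trans cz _; by rewrite leq_pmull.
- have -> : (2 * c * size ps = 2 * ((b - 9) * z) * size ps)%N by [].
  have b9 : (9 <= b)%N by apply: leq_trans b4.
  have E : (2 * ((b - 9) * z) * size ps)%:R = 2 * ((b%:R - 9) * z%:R) * (size ps)%:R :> R.
    by rewrite natrM natrM [((b - 9) * z)%:R]natrM natrB.
  rewrite -(ler_nat R) E; apply: (@capacity_bound R beta sigma n%:R t%:R k%:R b%:R z%:R) => //.
  + by move: b4R; clear; lra.
  + rewrite -!natrM -wz -cardF.
    have u1 : #|~: cover F|%:R <= n%:R / b%:R :> R.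
      by rewrite ler_pdivlMr // -natrM ler_nat mulnC.
    have cn : n%:R = #|cover F|%:R + #|~: cover F|%:R :> R by rewrite -natrD covn.
    have -> : (1 - 1 / b%:R) * n%:R = n%:R - n%:R / b%:R :> R.
      by field; rewrite gt_eqF.
    by move: u1 cn; clear; lra.
split; last by exists s.
by apply: leq_trans tbound; rewrite -addnA addnCA.
Qed.
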